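(* For blocks of $B=\Omega(\log N)$ bits: (i) there exists a 3-server protocol for stable compaction, i.e. a protocol that perfectly securely realizes the functionality $\mathcal{F}_{\rm compact}$ in the presence of a semi-honest adversary corrupting any single server, and that uses $O(N)$ bandwidth to compact an array of length $N$ that is secret-shared among the three servers; (ii) likewise, there exists a 3-server protocol for merging two sorted arrays of length $N$ that are secret-shared among the three servers, i.e. a protocol that perfectly securely realizes the functionality $\mathcal{F}_{\rm merge}$ in the presence of a semi-honest adversary corrupting any single server, and that uses $O(N)$ bandwidth.
   Context: **Model.** A trusted client interacts with three servers $\mathbf{S}_0,\mathbf{S}_1,\mathbf{S}_2$ (indices modulo $3$). All parties are probabilistic random access machines with memories consisting of $B$-bit blocks; the client has private memory of only $O(1)$ blocks. Protocols are passive-server: servers only answer read requests (address) and write requests (address, value) from the client, perform no computation, and do not talk to each other. Time proceeds in rounds; in each round at most one block can be exchanged between each pair of parties. Bandwidth is the total number of blocks transferred. The client can sample at unit cost a uniformly random block and a uniformly random element of $\{1,\dots,m\}$ for $m=O(N)$ (so a uniformly random permutation of $n=O(N)$ items can be generated in $O(n)$ time by Fisher–Yates). **Arrays.** Each entry of an array is a block which is either *real* (containing a payload and a logical address) or *dummy* ($\bot$). An array is *sorted* if all real blocks appear before all dummy blocks and the real blocks appear in increasing order of logical addresses (the relative order of real blocks with equal logical addresses may be arbitrary). **Secret-shared arrays.** An array $T$ is secret-shared as $T=T_0\oplus T_1\oplus T_2$ (entrywise bitwise XOR), where server $\mathbf{S}_b$ holds $T_b$ and $T_{b+1}$. **Functionalities.**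 $\mathcal{F}_{\rm compact}$: on input a secret-shared array $T$ of length $N$, let $T^*$ be the array obtained from $T$ by moving all dummy blocks to the end while keeping the relative order of the real blocks; sample $T'_0,T'_1$ of length $N$ independently and uniformly at random, set $T'_2:=T^*\oplus T'_0\oplus T'_1$, and output $(T'_b,T'_{b+1})$ to $\mathbf{S}_b$ for each $b$. $\mathcal{F}_{\rm merge}$: on input two secret-shared sorted arrays of length $N$, let $U$ be the sorted array of length $2N$ consisting of all blocks of both arrays, with all dummies at the end (ties between equal logical addresses broken by some fixed rule); sample $U_0,U_1$ of length $2N$ independently and uniformly at random, set $U_2:=U\oplus U_0\oplus U_1$, and output $(U_b,U_{b+1})$ to $\mathbf{S}_b$ for each $b$. The client has no input and no output ($\bot$). **Perfect security.** In a run of a protocol, the view of a corrupt server $\mathbf{S}_b$ consists of its input, its randomness, the ordered sequence of all messages it receives with their senders and rounds, and the honest communication pattern (which pairs of honest parties, including the client, exchange messages in which rounds). A protocol perfectly securely realizes $\mathcal{F}$ in the presence of a semi-honest adversary corrupting a single server if for every $b$ there is a simulator $\mathsf{Sim}$ such that for every input, the following two tuples are identically distributed: (ideal) run $\mathcal{F}$ with fresh randomness and output $\mathsf{Sim}(\text{input of }\mathbf{S}_b,\text{ output of }\mathbf{S}_b)$ together with the outputs of the client and of the other two servers; (real) run the protocol and output the view of $\mathbf{S}_b$ together with the outputs of the client and of the other two servers. *)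

(* Defs.v *)
From mathcomp Require Import all_boot all_order all_algebra.

Set Implicit Arguments.
Unset Strict Implicit.
Unset Printing Implicit Defensive.

Import GRing.Theory.
Local Open Scope nat_scope.

(* Randomized computations: finite trees of uniform choices among m.+1 values.
   Each tree has total mass 1. *)
Inductive rand (T : Type) : Type :=
| Ret of T
| Unif (m : nat) of ('I_m.+1 -> rand T).

Fixpoint bind (S T : Type) (p : rand S) (f : S -> rand T) : rand T :=
  match p with
  | Ret x => f x
  | Unif m k => Unif (fun i : 'I_m.+1 => bind (k i) f)
  end.

Fixpoint Pr (T : Type) (p : rand T) (E : pred T) : rat :=
  match p with
  | Ret x => (nat_of_bool (E x))%:R%R
  | Unif m k => ((\sum_(i < m.+1) Pr (k i) E) / m.+1%:R)%R
  end.

Definition same_dist (T : Type) (p q : rand T) : Prop :=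
  forall E : pred T, Pr p E = Pr q E.

(* The point i0 witnesses that I is nonempty; it does not affect the
   distribution. *)
Definition uniform (I : finType) (i0 : I) : rand I :=
  Unif (fun i : 'I_(#|I|.-1.+1) => Ret (nth i0 (enum I) i)).

(* A B-bit block is represented by the number having these bits. *)
Definition block (B : nat) : finType := 'I_(2 ^ B).

Lemma block_subproof B n : n %% 2 ^ B < 2 ^ B.
Proof. by rewrite ltn_pmod ?expn_gt0. Qed.

Definition to_block (B n : nat) : block B := Ordinal (block_subproof B n).

Definition xorb_block B (x y : block B) : block B :=
  to_block B (Nat.lxor x y).

(* Layout of the entries of an array, from the most significant bit: a flag
   telling real blocks, then the aw-bit logical address, then the payload.
   The dummy block is the all-zero block. *)
Definition dummy B : block B := to_block B 0.
Definition is_real B (x : block B) : bool := 2 ^ B.-1 <= x.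
Definition laddr B (aw : nat) (x : block B) : nat :=
  (x %% 2 ^ B.-1) %/ 2 ^ (B.-1 - aw).

Definition array (B n : nat) : finType := n.-tuple (block B).

Definition well_formed B n (X : array B n) : bool :=
  all (fun x => is_real x || (x == dummy B)) X.

(* "x may precede y": dummies come last, and real blocks are ordered by
   logical address; the relation is transitive. *)
Definition block_le B (aw : nat) (x y : block B) : bool :=
  is_real y ==> is_real x && (laddr aw x <= laddr aw y).

Definition sorted_array B (aw n : nat) (X : array B n) : bool :=
  sorted (block_le aw) X.

Definition xor_array B n (X Y : array B n) : array B n :=
  [tuple xorb_block (tnth X i) (tnth Y i) | i < n].

(* X b is the share T_b; server b holds X b and X (b + 1). *)
Definition sharing (B n : nat) : Type := 'Z_3 -> array B n.

Definition reconstruct B n (X : sharing B n) : array B n :=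
  xor_array (xor_array (X 0%R) (X 1%R)) (X 2%R).

Definition uniform_array B n : rand (array B n) :=
  uniform (I := array B n) [tuple dummy B | _ < n].

Definition fresh_sharing B n (Y : array B n) : rand (sharing B n) :=
  bind (uniform_array B n) (fun Y0 =>
  bind (uniform_array B n) (fun Y1 =>
  Ret (fun b : 'Z_3 =>
         if b == 0%R then Y0
         else if b == 1%R then Y1
         else xor_array Y (xor_array Y0 Y1)))).

(* Functionalities in which the servers obtain a sharing of an array of length
   outlen and the client has neither input nor output. *)
Record functionality (B : nat) := Functionality {
  input : Type;
  admissible : input -> bool;
  server_input : input -> 'Z_3 -> seq (block B);
  outlen : nat;
  ideal : input -> rand (sharing B outlen)
}.

Definition server_output (B n : nat) (Y : sharing B n) (b : 'Z_3) :
    array B n * array B n :=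
  (Y b, Y (b + 1)%R).

(* Reading past the end of the list of real blocks yields dummies. *)
Definition compacted B n (X : array B n) : array B n :=
  [tuple nth (dummy B) [seq x <- X | is_real x] i | i < n].

Definition F_compact (B N : nat) : functionality B := {|
  input := sharing B N;
  admissible X := well_formed (reconstruct X);
  server_input X b := X b ++ X (b + 1)%R;
  outlen := N;
  ideal X := fresh_sharing (compacted (reconstruct X))
|}.

(* Among equal logical addresses, the blocks of X come first. *)
Definition merged B (aw n : nat) (X Y : array B n) : array B (n + n) :=
  [tuple nth (dummy B) (merge (block_le aw) X Y) i | i < n + n].

Definition F_merge (B aw N : nat) : functionality B := {|
  input := sharing B N * sharing B N;
  admissible XY :=
    [&& well_formed (reconstruct XY.1), well_formed (reconstruct XY.2),
        sorted_array aw (reconstruct XY.1) & sorted_array aw (reconstruct XY.2)];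
  server_input XY b :=
    XY.1 b ++ XY.1 (b + 1)%R ++ XY.2 b ++ XY.2 (b + 1)%R;
  outlen := N + N;
  ideal XY := fresh_sharing (merged aw (reconstruct XY.1) (reconstruct XY.2))
|}.

(* The client is a probabilistic random access machine running a fixed program.
   A register holds a word of k blocks, i.e. a number below 2 ^ (k * B), where
   k is a constant of the protocol.  A program mentions finitely many registers,
   so the private memory of the client is O(1) blocks. *)
Definition word (k B n : nat) : nat := n %% 2 ^ (k * B).

Inductive binop :=
| OpAdd | OpSub | OpMul | OpDiv | OpMod | OpXor | OpShl | OpShr | OpEq | OpLt.

Definition eval_binop (o : binop) (x y : nat) : nat :=
  match o with
  | OpAdd => x + y
  | OpSub => x - y
  | OpMul => x * y
  | OpDiv => x %/ y
  | OpMod => x %% y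
  | OpXor => Nat.lxor x y
  | OpShl => x * 2 ^ y
  | OpShr => x %/ 2 ^ y
  | OpEq => x == y
  | OpLt => x < y
  end.

Inductive expr :=
| Cst (n : nat)
| Reg (r : nat)
| Bin (o : binop) (e1 e2 : expr).

Fixpoint eval (k B : nat) (rho : nat -> nat) (e : expr) : nat :=
  match e with
  | Cst n => word k B n
  | Reg r => rho r
  | Bin o e1 e2 => word k B (eval_binop o (eval k B rho e1) (eval k B rho e2))
  end.

(* SampleBlock r: put a uniform block in register r.
   Sample r e: put a uniform element of {1..m} in r, where m is the value of e.
   Read j r a: put in r the content of address a of server j.
   Write j a v: store v (modulo 2 ^ B) at address a of server j.
   Conditions hold when they evaluate to a nonzero number. *)
Inductive cmd :=
| Skip
| Assign (r : nat) (e : expr)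
| SampleBlock (r : nat)
| Sample (r : nat) (e : expr)
| Read (j : 'Z_3) (r : nat) (a : expr)
| Write (j : 'Z_3) (a v : expr)
| Seq (c1 c2 : cmd)
| If (e : expr) (c1 c2 : cmd)
| While (e : expr) (c : cmd).

(* width: number of blocks of a word.
   sample_range: Sample is available only for m <= sample_range * N. *)
Record protocol := Protocol {
  width : nat;
  sample_range : nat;
  code : cmd
}.

(* A message is one block, exchanged between the client and a server. *)
Inductive msg (B : nat) :=
| ReadAddr of block B
| WriteAddr of block B
| WriteVal of block B
| Reply of block B.

(* The item of index i of the trace is the message exchanged in round i and the
   server taking part in it.  Rounds advance with communication only. *)
Record state (B : nat) := State {
  regs : nat -> nat;
  memory : 'Z_3 -> nat -> block B;
  trace : seq ('Z_3 * msg B)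
}.

Definition upd (T : Type) (f : nat -> T) (x : nat) (v : T) : nat -> T :=
  fun y => if y == x then v else f y.

Definition set_reg k B (st : state B) (r v : nat) : state B :=
  State (upd (regs st) r (word k B v)) (memory st) (trace st).

(* The k blocks of a word, least significant first. *)
Definition digits (k B a : nat) : seq (block B) :=
  [seq to_block B (a %/ 2 ^ (i * B)) | i <- iota 0 k].

Definition do_read k B (st : state B) (j : 'Z_3) (r a : nat) : state B :=
  let v := memory st j a in
  State (upd (regs st) r (word k B v)) (memory st)
    (trace st ++ [seq (j, ReadAddr d) | d <- digits k B a] ++ [:: (j, Reply v)]).

Definition do_write k B (st : state B) (j : 'Z_3) (a v : nat) : state B :=
  State (regs st)
    (fun i => if i == j then upd (memory st i) a (to_block B v) else memory st i)
    (trace st ++ [seq (j, WriteAddr d) | d <- digits k B a]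
              ++ [:: (j, WriteVal (to_block B v))]).

(* None stands for a run which exhausts the bound on loop iterations or
   samples from an unavailable range. *)
Definition obind (S T : Type) (p : rand (option S)) (f : S -> rand (option T)) :
    rand (option T) :=
  bind p (fun o => if o is Some x then f x else Ret None).

Fixpoint while_loop (S : Type) (fuel : nat) (cond : S -> bool)
    (body : S -> rand (option S)) (x : S) : rand (option S) :=
  if cond x then
    if fuel is f.+1 then obind (body x) (while_loop f cond body)
    else Ret None
  else Ret (Some x).

Fixpoint exec (k s B N fuel : nat) (c : cmd) (st : state B) {struct c} :
    rand (option (state B)) :=
  match c with
  | Skip => Ret (Some st)
  | Assign r e => Ret (Some (set_reg k st r (eval k B (regs st) e)))
  | SampleBlock r =>
      bind (uniform (dummy B)) (fun x : block B => Ret (Some (set_reg k st r x)))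
  | Sample r e =>
      let m := eval k B (regs st) e in
      if 0 < m <= s * N then
        Unif (fun i : 'I_m.-1.+1 => Ret (Some (set_reg k st r i.+1)))
      else Ret None
  | Read j r a => Ret (Some (do_read k st j r (eval k B (regs st) a)))
  | Write j a v =>
      Ret (Some (do_write k st j (eval k B (regs st) a) (eval k B (regs st) v)))
  | Seq c1 c2 => obind (exec k s N fuel c1 st) (exec k s N fuel c2)
  | If e c1 c2 =>
      if eval k B (regs st) e != 0 then exec k s N fuel c1 st
      else exec k s N fuel c2 st
  | While e c1 =>
      while_loop fuel (fun st' => eval k B (regs st') e != 0)
        (exec k s N fuel c1) st
  end.

(* Registers 0, 1, 2 of the client initially hold the public parameters N, B
   and aw; the input of each server is at the beginning of its memory.  All
   remaining cells are zero. *)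
Definition init_state (P : protocol) (B N aw : nat)
    (inp : 'Z_3 -> seq (block B)) : state B :=
  State (fun r => word (width P) B (nth 0 [:: N; B; aw] r))
    (fun j a => nth (dummy B) (inp j) a) [::].

Definition run (P : protocol) (B N aw fuel : nat)
    (inp : 'Z_3 -> seq (block B)) : rand (option (state B)) :=
  exec (width P) (sample_range P) N fuel (code P) (init_state P N aw inp).

(* The output of a server consists of the first n + n cells of its memory. *)
Definition real_output B (n : nat) (st : state B) (j : 'Z_3) :
    array B n * array B n :=
  ([tuple memory st j i | i < n], [tuple memory st j (n + i) | i < n]).

(* The view of a server: its input and, for each round, the server talking to
   the client, together with the message if this is the corrupt server itself.
   Servers are passive, hence use no randomness, and their replies are
   determined by their input and the messages they receive. *)
Definition view (B : nat) : Type :=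
  seq (block B) * seq ('Z_3 * option (msg B)).

Definition view_of B (inp : 'Z_3 -> seq (block B)) (st : state B) (b : 'Z_3) :
    view B :=
  (inp b, [seq (jm.1, if jm.1 == b then Some jm.2 else None) | jm <- trace st]).

(* What is compared: the view of the corrupt server b, the output of the client
   (always tt) and those of the servers b + 1 and b + 2. *)
Definition outcome (B n : nat) : Type :=
  view B * unit * (array B n * array B n) * (array B n * array B n).

Definition real_outcome (P : protocol) B (F : functionality B) (N aw fuel : nat)
    (b : 'Z_3) (x : input F) : rand (option (outcome B (outlen F))) :=
  obind (run P N aw fuel (server_input x)) (fun st =>
    Ret (Some (view_of (server_input x) st b, tt,
               real_output (outlen F) st (b + 1)%R,
               real_output (outlen F) st (b + 2)%R))).

Definition ideal_outcome B (F : functionality B)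
    (Sim : seq (block B) -> array B (outlen F) * array B (outlen F) ->
           rand (view B))
    (b : 'Z_3) (x : input F) : rand (option (outcome B (outlen F))) :=
  bind (ideal x) (fun Y =>
  bind (Sim (server_input x b) (server_output Y b)) (fun v =>
    Ret (Some (v, tt, server_output Y (b + 1)%R, server_output Y (b + 2)%R)))).

(* As the outcome in the ideal world is never None, all runs terminate. *)
Definition perfectly_realizes (P : protocol) B (F : functionality B)
    (N aw fuel : nat) : Prop :=
  forall b : 'Z_3, exists Sim, forall x : input F, admissible x ->
    same_dist (ideal_outcome Sim b x) (real_outcome P N aw fuel b x).

(* Each message is one block, so the bandwidth of a run is the length of its
   trace. *)
Definition bandwidth_le (P : protocol) B (F : functionality B)
    (N aw fuel bound : nat) : Prop :=
  forall x : input F, admissible x ->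
    Pr (run P N aw fuel (server_input x))
       (fun o => if o is Some st then size (trace st) <= bound else false)
    = 1%R.

(* Main.v *)
(* Compaction and merging both amount to merging two linked lists threaded through
   one array of nodes: the real and the dummy blocks, respectively the two inputs.
   Node i is stored at p2 (p1 i) on servers 0 and 1, which hold a one-time pad and
   the padded node, for independent random permutations p1, unknown to server 0,
   and p2, unknown to server 1; only server 2, which never sees the list being
   traversed, knows both.  A node contains the location of its successor, so the
   client can merge the lists with O(1) memory by following pointers.  Each list
   ends with a sentinel, hence every node is fetched exactly once, and servers 0
   and 1 see the locations p2 (p1 (sigma t)), where the permutation sigma is the
   order of the visits, which depends on the data.  For server 0 the factor p1,
   and for server 1 the factor p2, makes this a uniform permutation independent of
   the rest of the view.  Accordingly, the coins of a run are uniform in a finite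
   set, and for every server a bijection of this set turns the real view into one
   which is computed from the input and the output of that server. *)

From Stdlib Require Import FunctionalExtensionality PeanoNat.
Require Import Defs.
From mathcomp Require Import all_boot all_order all_algebra all_fingroup.
From mathcomp Require Import zify.

Set Implicit Arguments.
Unset Strict Implicit.
Unset Printing Implicit Defensive.

Import GRing.Theory Num.Theory.
Local Open Scope nat_scope.
Local Notation obind := Defs.obind.

(** * Expectations over uniform choices *)

(** Two permutations are needed because of the order of the writes. Nodes are created in the public
    order of their indices, so servers 1 and 2, which receive them first, learn [p1]. The second
    stage runs through the positions under [p1]: server 0 then sees [p2] but not [p1]. The final
    copy to server 1 runs through the final positions, which hides [p2] from it. The second stage
    needs fresh pads because server 1 holds those of the first.

    The traversal makes [M + 2] fetches whatever the data are: the two heads, then one successor per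
    output entry.

    The formal obstacle is that a run is a decision tree, whereas the security argument permutes
    coins. Every phase is therefore shown to be the image of a fixed finite set of coins, which
    loops extend one iteration at a time; only then can coins be reindexed.

    The bound on the block size enters as [up_log 2 N <= d * B]: a word of [k = d + d + 10] blocks
    then holds every address, and also a block together with a location. *)

Fixpoint Ex (T : Type) (p : rand T) (g : T -> rat) : rat :=
  match p with
  | Ret x => g x
  | Unif m k => ((\sum_(i < m.+1) Ex (k i) g) / m.+1%:R)%R
  end.

Lemma PrE (T : Type) (p : rand T) (E : pred T) :
  Pr p E = Ex p (fun x => (nat_of_bool (E x))%:R%R).
Proof. by elim: p => //= m k IH; under eq_bigr do rewrite IH. Qed.

Lemma Ex_bind (S T : Type) (p : rand S) (f : S -> rand T) g :
  Ex (bind p f) g = Ex p (fun x => Ex (f x) g).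
Proof. by elim: p => //= m k IH; under eq_bigr do rewrite IH. Qed.

(** Quantifying over all rational functions [g], and not over events only, makes the notion compose:
    under [bind], the probability of an event after the second step is such a [g] of the first
    result. *)
Definition samples (I : finType) (T : Type) (p : rand T) (F : I -> T) : Prop :=
  forall g, Ex p g = ((\sum_i g (F i)) / #|I|%:R)%R.

Lemma samples_bind (I J : finType) (S T : Type) (p : rand S) (F : I -> S)
    (f : S -> rand T) (G : I -> J -> T) :
  samples p F -> (forall i, samples (f (F i)) (G i)) ->
  samples (bind p f) (fun ij : I * J => G ij.1 ij.2).
Proof.
move=> hp hf g; rewrite Ex_bind hp.
under eq_bigr do rewrite hf.
rewrite -mulr_suml pair_bigA /= card_prod natrM invfM -mulrA.
by congr (_ * _)%R; rewrite mulrC.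
Qed.

Lemma samples_map (I : finType) (S T : Type) (p : rand S) (F : I -> S) (h : S -> T) :
  samples p F -> samples (bind p (fun x => Ret (h x))) (h \o F).
Proof. by move=> hp g; rewrite Ex_bind /= hp. Qed.

Lemma samples_uniform (I : finType) (i0 : I) : samples (uniform i0) id.
Proof.
move=> g; rewrite /= prednK; last by apply/card_gt0P; exists i0.
congr (_ / _)%R; have -> : (\sum_i g (id i) = \sum_(i <- enum I) g i)%R by rewrite big_enum.
by rewrite (big_nth i0) -cardE big_mkord.
Qed.

Lemma samples_reindex (I J : finType) (T : Type) (p : rand T) (F : I -> T)
    (h : J -> I) :
  bijective h -> samples p F -> samples p (F \o h).
Proof.
move=> hb hp g; rewrite hp (bij_eq_card hb); congr (_ / _)%R.
by case: (hb) => h' hK h'K; rewrite (reindex h) //; exists h' => x _.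
Qed.

Lemma samples_same_dist (I : finType) (T : Type) (p q : rand T) (F G : I -> T) :
  samples p F -> samples q G -> F =1 G -> same_dist p q.
Proof.
by move=> hp hq FG E; rewrite !PrE hp hq; congr (_ / _)%R; apply: eq_bigr => i _;
  rewrite FG.
Qed.

(* p never fails, and its result is distributed as the image of a uniform
   element i of I by a function whose value at i satisfies Q i. *)
Definition covers (I : finType) (T : Type) (p : rand (option T))
    (Q : I -> T -> Prop) : Prop :=
  exists2 F : I -> T, samples p (Some \o F) & forall i, Q i (F i).

Lemma covers_impl (I : finType) (T : Type) (p : rand (option T))
    (Q R : I -> T -> Prop) :
  covers p Q -> (forall i x, Q i x -> R i x) -> covers p R.
Proof. by case=> F hF hQ QR; exists F => // i; apply: QR. Qed.

Lemma covers_bind (I J : finType) (S T : Type) (p : rand (option S))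
    (f : S -> rand (option T)) Q (R : I -> J -> T -> Prop) :
  covers p Q -> (forall i x, Q i x -> covers (f x) (R i)) ->
  covers (obind p f) (fun ij : I * J => R ij.1 ij.2).
Proof.
case=> F hF hQ hf.
(* The coins being finitely many, the witnesses [G] can be picked for all of them at once. *)
have /fin_all_exists [G hG] : forall i, exists G : J -> T,
    samples (f (F i)) (Some \o G) /\ forall j, R i j (G j).
  by move=> i; have [G ? ?] := hf i _ (hQ i); exists G.
exists (fun ij => G ij.1 ij.2) => [|[i j]]; last exact: (hG i).2.
by apply: (samples_bind (G := fun i => Some \o G i)) hF _ => i; apply: (hG i).1.
Qed.

Lemma covers_bind_det (I : finType) (S T : Type) (p : rand (option S))
    (f : S -> rand (option T)) Q (R : I -> T -> Prop) :
  covers p Q ->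
  (forall i x, Q i x -> exists2 y, f x = Ret (Some y) & R i y) ->
  covers (obind p f) R.
Proof.
case=> F hF hQ hf.
have /fin_all_exists [G hG] : forall i, exists y, f (F i) = Ret (Some y) /\ R i y.
  by move=> i; have [y ? ?] := hf i _ (hQ i); exists y.
exists G => [g|i]; last exact: (hG i).2.
rewrite Ex_bind hF; congr (_ / _)%R; apply: eq_bigr => i _ /=.
by rewrite (hG i).1.
Qed.

Lemma covers_reindex (I J : finType) (T : Type) (p : rand (option T)) Q
    (h : J -> I) :
  bijective h -> covers p Q -> covers p (fun j => Q (h j)).
Proof.
move=> hb [F hF hQ]; exists (F \o h) => [|j]; last exact: hQ.
exact: (samples_reindex hb hF).
Qed.

Lemma covers_ret (T : Type) (x : T) (Q : unit -> T -> Prop) :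
  Q tt x -> covers (Ret (Some x)) Q.
Proof.
move=> Qx; exists (fun=> x) => [g|[]//].
by rewrite /= card_unit divr1 (big_pred1 tt) // => -[].
Qed.

Lemma covers_unif (n : nat) (T : Type) (F : 'I_n.+1 -> T) Q :
  (forall i, Q i (F i)) -> covers (Unif (fun i => Ret (Some (F i)))) Q.
Proof. by move=> hQ; exists F => // g; rewrite /= card_ord. Qed.

Lemma covers_uniform (I : finType) (i0 : I) (T : Type) (F : I -> T) Q :
  (forall i, Q i (F i)) -> covers (bind (uniform i0) (fun i => Ret (Some (F i)))) Q.
Proof.
move=> hQ; exists F => // g; rewrite Ex_bind samples_uniform //.
Qed.

(** The coins of the first [n] iterations of a loop, latest outermost, so that an invariant at
    iteration [t] speaks of exactly the coins drawn so far. [J] depends on the iteration because the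
    ranges of Fisher-Yates grow. *)
Fixpoint tape (J : nat -> finType) (n : nat) : finType :=
  if n is m.+1 then (tape J m * J m)%type else unit.

Lemma covers_while (S : Type) (J : nat -> finType) (n fuel : nat)
    (cond : S -> bool) (body : S -> rand (option S))
    (Inv : forall t, tape J t -> S -> Prop) (x : S) :
  n <= fuel ->
  (forall w y, Inv n w y -> cond y = false) ->
  (forall t w y, t < n -> Inv t w y ->
     cond y /\ covers (body y) (fun (j : J t) => Inv t.+1 (w, j))) ->
  Inv 0 tt x ->
  covers (while_loop fuel cond body x) (Inv n).
Proof.
move=> nf hend hstep h0.
(* The loop consumes coins from iteration [t] on, while a tape grows at its outer end. [U] collects
   the coins still to come and [e] appends them to the tape of the first [t] iterations. *)
suff H m t f : t + m = n -> m <= f -> exists (U : finType) (e : tape J t * U -> tape J n),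
    bijective e /\ forall w y, Inv t w y ->
    covers (while_loop f cond body y) (fun u => Inv n (e (w, u))).
  have [U [e [be /(_ tt x h0) [F hF hQ]]]] := H n 0 fuel (add0n n) nf.
  have [e' eK e'K] := be.
  have hb : bijective (fun w => (e' w).2).
    exists (fun u => e (tt, u)) => [w|u]; last by rewrite eK.
    by rewrite -[RHS]e'K; case: (e' w) => -[].
  exists (fun w => F (e' w).2) => [|w]; first exact: (samples_reindex hb hF).
  have := hQ (e' w).2; suff -> : e (tt, (e' w).2) = w by [].
  by rewrite -[RHS]e'K; case: (e' w) => -[].
elim: m t f => [|m IH] t f.
  rewrite addn0 => -> {t} _; exists unit, fst; split.
    by exists (fun w => (w, tt)) => // -[w []].
  move=> w y hy; have nc := hend _ _ hy.
  by case: f => [|f] /=; rewrite nc; apply: covers_ret.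
case: f => // f; rewrite addnS -addSn ltnS => tm mf.
have tn : t < n by rewrite -tm leq_addr.
have [U [e [[e' eK e'K] he]]] := IH t.+1 f tm mf.
exists (J t * U)%type, (fun wu => e ((wu.1, wu.2.1), wu.2.2)); split.
  exists (fun w => ((e' w).1.1, ((e' w).1.2, (e' w).2))) => [[w [j u]]|w] /=.
    by rewrite eK.
  by rewrite -[RHS]e'K; case: (e' w) => [[]].
move=> w y hy; have [/= -> hb] := hstep _ _ _ tn hy.
apply: (covers_bind (R := fun j u => Inv n (e ((w, j), u))) hb) => j z hz.
exact: (he (w, j)).

Qed.

Lemma samples_Pr1 (I : finType) (T : Type) (p : rand T) (F : I -> T) (E : pred T) :
  0 < #|I| -> samples p F -> (forall i, E (F i)) -> Pr p E = 1%R.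
Proof.
move=> I0 hp hE; rewrite PrE hp (eq_bigr (fun=> 1%R)) => [|i _]; last by rewrite hE.
by rewrite sumr_const divff // pnatr_eq0 -lt0n.
Qed.

(** * Blocks, words and messages *)

Lemma expn_pow m n : m ^ n = Nat.pow m n.
Proof. by elim: n => //= n IH; rewrite expnS IH mulnE. Qed.

Lemma lxor_lt n a b : a < 2 ^ n -> b < 2 ^ n -> Nat.lxor a b < 2 ^ n.
Proof.
move=> an bn; have [->|/eqP x0] := eqVneq (Nat.lxor a b) 0; first by rewrite expn_gt0.
have lg m : m < 2 ^ n -> m = 0 \/ (Nat.log2 m < n)%coq_nat.
  case: m => [|m] mn; [by left|right]; apply/Nat.log2_lt_pow2; first by lia.
  by rewrite -expn_pow; apply/ltP.
apply/ltP; rewrite expn_pow; apply/Nat.log2_lt_pow2; first by lia.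
apply: Nat.le_lt_trans (Nat.log2_lxor a b) _.
have n0 : 0 < n.
  case: n an bn {lg} => //; rewrite expn0 !ltnS !leqn0 => /eqP a0 /eqP b0.
  by move: x0; rewrite a0 b0.
by apply: Nat.max_lub_lt; [case: (lg _ an) => [->|//]|case: (lg _ bn) => [->|//]];
  apply/ltP.
Qed.

Section Blocks.
Variable B : nat.
Implicit Types x y z : block B.

Lemma to_block_id x : to_block B x = x.
Proof. by apply: ord_inj; rewrite /= modn_small. Qed.

Lemma val_xorb x y : xorb_block x y = Nat.lxor x y :> nat.
Proof. by rewrite /= modn_small // lxor_lt. Qed.

Lemma xorbC x y : xorb_block x y = xorb_block y x.
Proof. by apply: ord_inj; rewrite !val_xorb Nat.lxor_comm. Qed.

Lemma xorbK x y : xorb_block (xorb_block x y) y = x.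
Proof.
by apply: ord_inj; rewrite !val_xorb Nat.lxor_assoc Nat.lxor_nilpotent Nat.lxor_0_r.
Qed.

Lemma xorb_inj x : injective (xorb_block x).
Proof. by move=> y z; rewrite ![xorb_block x _]xorbC => e; rewrite -(xorbK y x) e xorbK. Qed.
End Blocks.

Section Words.
Variables k B : nat.

Definition num (n : nat) (f : nat -> nat) : nat := \sum_(i < n) f i * 2 ^ (i * B).

Lemma num_lt n f : (forall i, f i < 2 ^ B) -> num n f < 2 ^ (n * B).
Proof.
move=> fB; elim: n => [|n IH]; first by rewrite /num big_ord0.
rewrite /num big_ord_recr /= -/(num n f) mulSn expnD.
have := fB n; move: (2 ^ B) (2 ^ (n * B)) (num n f) IH => b w m; nia.
Qed.

Lemma num_digit n f i : (forall i, f i < 2 ^ B) -> i < n ->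
  (num n f %/ 2 ^ (i * B)) %% 2 ^ B = f i.
Proof.
move=> fB; elim: n => // n IH; rewrite ltnS leq_eqVlt => /orP [/eqP ->|lin];
  rewrite /num big_ord_recr /= -/(num n f) addnC.
  by rewrite divnMDl ?expn_gt0 // divn_small ?num_lt // addn0 modn_small.
have -> : n * B = (n - i).-1 * B + B + i * B.
  by rewrite -[X in _ + X + _]mul1n -!mulnDl; congr (_ * _); lia.
rewrite 2!expnD !mulnA divnMDl ?expn_gt0 // modnMDl; exact: IH.
Qed.

Lemma num_digits n v :
  num n (fun i => (v %/ 2 ^ (i * B)) %% 2 ^ B) = v %% 2 ^ (n * B).
Proof.
elim: n => [|n IH]; first by rewrite /num big_ord0 modn1.
rewrite /num big_ord_recr /= [X in X + _]IH mulSn expnD modn_divl.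
rewrite addnC [RHS](divn_eq _ (2 ^ (n * B))); congr (_ + _).
by rewrite modn_dvdm // dvdn_mull.
Qed.

Definition getw (m : nat -> block B) (w : nat) : nat := num k (fun i => m (w * k + i)).

Definition updw (m : nat -> block B) (w v : nat) : nat -> block B := fun a =>
  if w * k <= a < w.+1 * k then to_block B (v %/ 2 ^ ((a - w * k) * B)) else m a.

Lemma getw_lt m w : getw m w < 2 ^ (k * B).
Proof. by apply: num_lt => i. Qed.

Lemma getw_digit m w i : i < k ->
  to_block B (getw m w %/ 2 ^ (i * B)) = m (w * k + i).
Proof. by move=> ik; apply: ord_inj; rewrite /= num_digit // => j. Qed.

Lemma getw_updw m w v w' : v < 2 ^ (k * B) ->
  getw (updw m w v) w' = if w' == w then v else getw m w'.
Proof.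
move=> vW; case: eqVneq => [->|neq].
  rewrite -[RHS](modn_small vW) -num_digits; apply: eq_bigr => i _.
  rewrite /updw leq_addr mulSn [k + _]addnC ltn_add2l ltn_ord /=.
  by rewrite addnC addnK.
apply: eq_bigr => i _; rewrite /updw; case: ifP => // h; exfalso.
have := ltn_ord i; have : w < w' \/ w' < w by lia.
move: h; nia.
Qed.

Lemma updw_low m w v a : a < w * k -> updw m w v a = m a.
Proof. by rewrite /updw => h; rewrite leqNgt h. Qed.

Lemma getw_upd m a x w : a < w * k -> getw (upd m a x) w = getw m w.
Proof.
move=> h; apply: eq_bigr => i _; rewrite /upd; case: eqP => // e; lia.
Qed.

Lemma getw_zero m w : (forall a, w * k <= a -> m a = dummy B) -> getw m w = 0.
Proof.
move=> h; rewrite /getw /num big1 // => i _.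
by rewrite h ?leq_addr //= mod0n.
Qed.

(* An access to the single cell eadr, or, if ewide, to the k cells of the word
   eadr. *)
Record event := Event {
  ewide : bool; ewrite : bool; esrv : 'Z_3; eadr : nat; evalue : nat }.

Definition expand1 (wr : bool) (j : 'Z_3) (a v : nat) : seq ('Z_3 * msg B) :=
  [seq (j, if wr then WriteAddr d else ReadAddr d) | d <- digits k B a] ++
  [:: (j, if wr then WriteVal (to_block B v) else Reply (to_block B v))].

Definition expand (e : event) : seq ('Z_3 * msg B) :=
  let: Event wide wr j a v := e in
  if wide then
    flatten [seq expand1 wr j (a * k + i) (v %/ 2 ^ (i * B)) | i <- iota 0 k]
  else expand1 wr j a v.

Definition expands (es : seq event) := flatten (map expand es).

Lemma expands_cat es fs : expands (es ++ fs) = expands es ++ expands fs.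
Proof. by rewrite /expands map_cat flatten_cat. Qed.

Lemma expands_rcons es e : expands (es ++ [:: e]) = expands es ++ expand e.
Proof. by rewrite expands_cat /expands /= cats0. Qed.

Definition redact_msgs (b : 'Z_3) (t : seq ('Z_3 * msg B)) :=
  [seq (jm.1, if jm.1 == b then Some jm.2 else None) | jm <- t].

(** Of an access to another server only its kind and its target survive; they already determine the
    number of rounds, hence the communication pattern. *)
Definition redact (b : 'Z_3) (e : event) : event :=
  if esrv e == b then e else Event (ewide e) (ewrite e) (esrv e) 0 0.

Lemma redact_expand1 b wr j a v a' v' : j != b ->
  redact_msgs b (expand1 wr j a v) = redact_msgs b (expand1 wr j a' v').
Proof.
move=> /negbTE jb; rewrite /redact_msgs !map_cat -!map_comp /= jb; congr (_ ++ _).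
by rewrite /digits; apply: eq_map => i /=; rewrite jb.
Qed.

Lemma redact_expand b e : redact_msgs b (expand (redact b e)) = redact_msgs b (expand e).
Proof.
case: e => wide wr j a v; rewrite /redact /=; case: eqP => // /eqP jb.
case: wide => /=; last exact: redact_expand1.
rewrite /redact_msgs !map_flatten -!map_comp; congr flatten; apply: eq_map => i.
exact: redact_expand1.
Qed.

(** Reduces the comparison of views, which are sequences of messages, to that of short lists of
    events. It works because the number of messages of an access depends neither on its address nor
    on its value. *)
Lemma redact_expands b es fs : map (redact b) es = map (redact b) fs ->
  redact_msgs b (expands es) = redact_msgs b (expands fs).
Proof.
move=> H; suff E hs : redact_msgs b (expands hs) =
    flatten [seq redact_msgs b (expand e) | e <- map (redact b) hs].
  by rewrite !E H.
elim: hs => //= e hs IH; rewrite /expands /= /redact_msgs map_cat.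
by congr (_ ++ _); [symmetry; exact: redact_expand|exact: IH].
Qed.

(** A wide access touches [k] cells, each at the cost of [k] address blocks and one value. *)
Lemma size_expands es : size (expands es) <= size es * (k.+1 * k.+1).
Proof.
have s1 wr j a v : size (expand1 wr j a v) = k.+1.
  by rewrite size_cat !size_map size_iota addn1.
elim: es => //= [[wide wr j a v] es IH]; rewrite /expands /= size_cat mulSn.
apply: leq_add IH; case: wide; last by rewrite s1 leq_pmulr.
rewrite size_flatten /shape -map_comp (@eq_map _ _ _ (fun=> k.+1)).
  by rewrite sumnE big_map big_const_seq count_predT size_iota iter_addn_0; lia.
by move=> i /=; rewrite s1.
Qed.

End Words.

(** * Symbolic execution of commands *)

Lemma obindA (S T U : Type) (p : rand (option S)) (f : S -> rand (option T))
    (g : T -> rand (option U)) :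
  obind (obind p f) g = obind p (fun x => obind (f x) g).
Proof.
elim: p => [[x|]|m c IH] //=; rewrite /obind /=; congr Unif.
by apply: functional_extensionality => i; apply: IH.
Qed.

Definition seqs (cs : seq cmd) : cmd := foldr Seq Skip cs.

(* Register 4 holds the number L of nodes; area c of a server consists of its
   words c * L, ..., c * L + L - 1.  The input and the output of a server lie in
   the cells of areas 0 and 1. *)
Definition area_word (c : nat) (e : expr) : expr := Bin OpAdd (Bin OpMul (Cst c) (Reg 4)) e.

Definition digit_addr (k i : nat) : expr :=
  Bin OpAdd (Bin OpMul (Reg 6) (Cst k)) (Cst i).
Definition digit_shift (i : nat) : expr := Bin OpMul (Cst i) (Reg 1).

(* The address goes through register 6 and the value through register 8. *)
Definition rdw (k : nat) (j : 'Z_3) (a : expr) : cmd := seqs (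
  Assign 6 a :: Assign 8 (Cst 0) ::
  flatten [seq [:: Read j 7 (digit_addr k i);
                   Assign 8 (Bin OpAdd (Reg 8) (Bin OpShl (Reg 7) (digit_shift i)))]
          | i <- iota 0 k] ++ [:: Assign 7 (Cst 0)]).

Definition wrw (k : nat) (j : 'Z_3) (a v : expr) : cmd := seqs (
  Assign 8 v :: Assign 6 a ::
  [seq Write j (digit_addr k i) (Bin OpShr (Reg 8) (digit_shift i)) | i <- iota 0 k]).

Definition sampw (k : nat) : cmd := seqs (
  Assign 8 (Cst 0) ::
  flatten (nseq k [:: SampleBlock 7;
                      Assign 8 (Bin OpAdd (Bin OpShl (Reg 8) (Reg 1)) (Reg 7))])
  ++ [:: Assign 7 (Cst 0)]).

Ltac upd_ext :=
  let r := fresh "r" in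
  apply: functional_extensionality => r; rewrite /upd;
  repeat (case: eqP => ?); try by []; try congruence.

Section Machine.
Variables k s B N fuel : nat.
Hypothesis k_gt0 : 0 < k.
Hypothesis B_gt0 : 0 < B.
Local Notation W := (2 ^ (k * B)).
Local Notation exec := (exec k s N fuel).
Implicit Types (st : state B) (R : nat -> nat) (m : 'Z_3 -> nat -> block B).

(** Total correctness of coin-free code. The rules below peel off the first command and leave the
    rest in [cs], so that a body is executed symbolically from left to right. *)
Definition det (cs : seq cmd) st (Q : state B -> Prop) : Prop :=
  exists2 y, exec (seqs cs) st = Ret (Some y) & Q y.

Lemma exec_cat cs ds st :
  exec (seqs (cs ++ ds)) st = obind (exec (seqs cs) st) (exec (seqs ds)).
Proof.
elim: cs st => //= c cs IH st; rewrite obindA; congr (obind _ _).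
by apply: functional_extensionality => x; apply: IH.
Qed.

Lemma det_nil st (Q : state B -> Prop) : Q st -> det [::] st Q.
Proof. by exists st. Qed.

Lemma det_cat cs ds st Q :
  det cs st (fun y => det ds y Q) -> det (cs ++ ds) st Q.
Proof. by case=> y e [z e' h]; exists z => //; rewrite exec_cat e. Qed.

Lemma det_impl cs st (Q Q' : state B -> Prop) :
  det cs st Q -> (forall y, Q y -> Q' y) -> det cs st Q'.
Proof. by case=> y e h QQ; exists y => //; apply: QQ. Qed.

Lemma det_step c cs st st1 Q :
  exec c st = Ret (Some st1) -> det cs st1 Q -> det (c :: cs) st Q.
Proof. by move=> e [y e' h]; exists y => //=; rewrite e. Qed.

Lemma det_seqs cs ds st Q : det (cs ++ ds) st Q -> det (seqs cs :: ds) st Q.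
Proof. by case=> y e h; exists y => //; rewrite -e exec_cat. Qed.

Lemma digit_lt_W (x : block B) : x < W.
Proof. by apply: leq_trans (ltn_ord x) _; rewrite leq_exp2l // leq_pmull. Qed.

Lemma word_small v : v < W -> word k B v = v.
Proof. exact: modn_small. Qed.

Lemma ev_cst R n : n < W -> eval k B R (Cst n) = n.
Proof. exact: word_small. Qed.

Lemma ev_reg R r v : R r = v -> eval k B R (Reg r) = v.
Proof. by []. Qed.

Lemma ev_bin R o e1 e2 v1 v2 : eval k B R e1 = v1 -> eval k B R e2 = v2 ->
  eval_binop o v1 v2 < W -> eval k B R (Bin o e1 e2) = eval_binop o v1 v2.
Proof. by move=> /= -> ->; apply: word_small. Qed.

Lemma det_assign cs R m t r e v Q : eval k B R e = v -> v < W ->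
  det cs (State (upd R r v) m t) Q -> det (Assign r e :: cs) (State R m t) Q.
Proof.
move=> ev vW; apply: det_step => /=.
by rewrite /set_reg /= ev word_small.
Qed.

Lemma det_if cs as1 as2 R m t e v Q : eval k B R e = v ->
  det ((if v != 0 then as1 else as2) ++ cs) (State R m t) Q ->
  det (If e (seqs as1) (seqs as2) :: cs) (State R m t) Q.
Proof.
by move=> ev /det_seqs [y e' h]; exists y; rewrite // -e' /= ev; case: ifP.
Qed.

Lemma det_read cs R m t j r a A Q : eval k B R a = A ->
  det cs (State (upd R r (m j A)) m
     (t ++ expand k B (Event false false j A (m j A)))) Q ->
  det (Read j r a :: cs) (State R m t) Q.
Proof.
move=> ev; apply: det_step => /=.
by rewrite /do_read /= ev word_small ?digit_lt_W // /expand1 to_block_id.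
Qed.

Definition updm m j (f : (nat -> block B) -> nat -> block B) : 'Z_3 -> nat -> block B :=
  fun i => if i == j then f (m i) else m i.

Lemma det_write cs R m t j a v A V Q : eval k B R a = A -> eval k B R v = V ->
  det cs (State R (updm m j (fun f => upd f A (to_block B V)))
     (t ++ expand k B (Event false true j A V))) Q ->
  det (Write j a v :: cs) (State R m t) Q.
Proof. by move=> ea ev; apply: det_step => /=; rewrite /do_write /= ea ev. Qed.

Lemma shift_lt i : i <= k -> i * B < W.
Proof.
by move=> ik; apply: (@leq_ltn_trans (k * B)); rewrite ?leq_mul2r ?ik ?orbT // ltn_expl.
Qed.

Lemma word_addr_lt A : A * k + k <= W -> A < W.
Proof.
have := leq_pmulr A k_gt0; move: W k_gt0 => w; move: (A * k) => u; lia.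
Qed.

Lemma ev_digit_addr R A i : R 6 = A -> A * k + k <= W -> i < k ->
  eval k B R (digit_addr k i) = A * k + i.
Proof.
move=> R6 AW ik; have kW : k < W.
  by apply: leq_ltn_trans (leq_pmulr k B_gt0) (shift_lt _).
apply: (ev_bin (o := OpAdd)).
- apply: (ev_bin (o := OpMul)) => /=; [exact: R6|exact: ev_cst|nia].
- by apply: ev_cst; lia.
- by rewrite /=; lia.
Qed.

Lemma ev_digit_shift R i : R 1 = B -> i < k ->
  eval k B R (digit_shift i) = i * B.
Proof.
move=> R1 ik; have kW : k < W.
  by apply: leq_ltn_trans (leq_pmulr k B_gt0) (shift_lt _).
apply: (ev_bin (o := OpMul)); [exact: ev_cst (ltn_trans ik kW)|exact: R1|].

exact: shift_lt (ltnW ik).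
Qed.

Lemma det_rdw cs R m t j a A Q : R 1 = B -> eval k B R a = A -> A * k + k <= W ->
  det cs (State (upd (upd (upd R 6 A) 7 0) 8 (getw k (m j) A)) m
     (t ++ expand k B (Event true false j A (getw k (m j) A)))) Q ->
  det (rdw k j a :: cs) (State R m t) Q.
Proof.
move=> R1 ea AW H; apply: det_seqs; rewrite /=.
apply: (det_assign (v := A)) => //; first exact: word_addr_lt.
apply: (det_assign (v := 0)) => //; first by rewrite ev_cst ?expn_gt0.
  by rewrite expn_gt0.
rewrite -catA; apply: det_cat.
(* Register 7 keeps the last digit read, hence the existential [z]; the final assignment clears it,
   so that the end state depends on the word alone. *)
suff P n : n <= k -> det (flatten [seq [:: Read j 7 (digit_addr k i);
      Assign 8 (Bin OpAdd (Reg 8) (Bin OpShl (Reg 7) (digit_shift i)))] | i <- iota 0 n])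
   (State (upd (upd R 6 A) 8 0) m (t))
   (fun y => exists z, y = State
      (upd (upd (upd R 6 A) 7 z) 8 (num B n (fun i => m j (A * k + i)))) m
      (t ++ flatten [seq expand1 k B false j (A * k + i) (getw k (m j) A %/ 2 ^ (i * B))
        | i <- iota 0 n])).
  apply: det_impl (P k (leqnn k)) _ => y [z ->]; apply: (det_assign (v := 0)).
  - by rewrite ev_cst ?expn_gt0.
  - by rewrite expn_gt0.
  move: H; rewrite /=; congr (det _ (State _ _ _) _); upd_ext.
elim: n => [_|n IH nk].
  apply: det_nil; exists (R 7); rewrite /= cats0; congr State.
  by rewrite /num big_ord0; upd_ext.
have -> : iota 0 n.+1 = iota 0 n ++ [:: n] by rewrite -[n.+1]addn1 iotaD.
rewrite !map_cat !flatten_cat /=; apply: det_cat.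
apply: det_impl (IH (ltnW nk)) _ => y [z ->].
apply: det_read; first exact: (ev_digit_addr (A := A)).
have nB : forall n, n <= k -> num B n (fun i => m j (A * k + i)) < W.
  move=> n' n'k; apply: leq_trans (num_lt (B := B) n' _) _ => //.
  by rewrite leq_exp2l // leq_mul2r n'k orbT.
pose f i : nat := m j (A * k + i).
have fS : num B n.+1 f = num B n f + f n * 2 ^ (n * B) by rewrite /num big_ord_recr.
have fW := nB n.+1 nk; rewrite -/f fS in fW.
apply: (det_assign (v := num B n.+1 f)); last 1 first.
- apply: det_nil; exists (m j (A * k + n)); congr State; first by upd_ext.
  by rewrite -catA /expand1 /= /expand1 getw_digit // cats0 to_block_id.
- rewrite fS; apply: (ev_bin (o := OpAdd)) => //.
  apply: (ev_bin (o := OpShl)); [exact: ev_reg|exact: ev_digit_shift|rewrite /=].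
  by apply: leq_ltn_trans fW; rewrite leq_addl.
- by rewrite fS.
Qed.

Lemma det_wrw cs R m t j a v A V Q : R 1 = B -> eval k B R v = V -> V < W ->
  eval k B (upd R 8 V) a = A -> A * k + k <= W ->
  det cs (State (upd (upd R 8 V) 6 A) (updm m j (fun f => updw k f A V))
     (t ++ expand k B (Event true true j A V))) Q ->
  det (wrw k j a v :: cs) (State R m t) Q.
Proof.
move=> R1 ev VW ea AW H; apply: det_seqs; rewrite /=.
apply: (det_assign (v := V)) => //.
apply: (det_assign (v := A)) => //; first exact: word_addr_lt.
apply: det_cat.
suff P n : n <= k -> det
   [seq Write j (digit_addr k i) (Bin OpShr (Reg 8) (digit_shift i)) | i <- iota 0 n]
   (State (upd (upd R 8 V) 6 A) m (t))
   (fun y => y = State (upd (upd R 8 V) 6 A)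
      (updm m j (fun f a => if A * k <= a < A * k + n 
        then to_block B (V %/ 2 ^ ((a - A * k) * B)) else f a))
      (t ++ flatten [seq expand1 k B true j (A * k + i) (V %/ 2 ^ (i * B)) | i <- iota 0 n])).
  apply: det_impl (P k (leqnn k)) _ => y ->.
  move: H; rewrite /=; congr (det _ (State _ _ _) _); apply: functional_extensionality => i.
  by rewrite /updm; case: eqP => // _; apply: functional_extensionality => b;
    rewrite /updw mulSn addnC.
elim: n => [_|n IH nk].
  apply: det_nil; rewrite /= cats0; congr State.
  apply: functional_extensionality => i; rewrite /updm; case: eqP => // _.
  by apply: functional_extensionality => b; case: ifP => //; lia.
have -> : iota 0 n.+1 = iota 0 n ++ [:: n] by rewrite -[n.+1]addn1 iotaD.
rewrite !map_cat !flatten_cat /=; apply: det_cat.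
apply: det_impl (IH (ltnW nk)) _ => y ->.
apply: det_write; first exact: (ev_digit_addr (A := A)).
  apply: (ev_bin (o := OpShr)); [exact: ev_reg|exact: ev_digit_shift|rewrite /=].
  by apply: leq_ltn_trans VW; apply: leq_div.
apply: det_nil; rewrite -catA cats0; congr State.
apply: functional_extensionality => i; rewrite /updm; case: eqP => // _.
apply: functional_extensionality => b; rewrite /upd; case: eqP => [->|ne].
  by rewrite leq_addr ltn_add2l ltnSn addKn.
by congr (if _ then _ else _); lia.
Qed.

Definition split_word (n : nat) (r : block (n.+1 * B)) : block (n * B) * block B :=
  (to_block (n * B) (r %/ 2 ^ B), to_block B r).

(** The block sampled last is the least significant one, so sampling block after block amounts to
    sampling a uniform word. *)
Lemma split_word_bij n : bijective (@split_word n).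
Proof.
exists (fun ab : block (n * B) * block B => to_block (n.+1 * B) (ab.1 * 2 ^ B + ab.2)) => [r|[a b]].
  apply: ord_inj; rewrite /= [(r %/ _) %% _]modn_small.
    by rewrite -divn_eq modn_small.
  by rewrite ltn_divLR ?expn_gt0 // -expnD addnC -mulSn.
have ab : a * 2 ^ B + b < 2 ^ (n.+1 * B).
  rewrite mulSn expnD; have := ltn_ord a; have := ltn_ord b.
  move: (2 ^ B) (2 ^ (n * B)) (nat_of_ord a) (nat_of_ord b) => x y u v; nia.
congr pair; apply: ord_inj; rewrite /= (modn_small ab).
  by rewrite divnMDl ?expn_gt0 // divn_small // addn0 modn_small.
by rewrite modnMDl modn_small.
Qed.

Lemma covers_sampw R m t : R 1 = B ->
  covers (I := block (k * B)) (exec (sampw k) (State R m t))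
    (fun r y => y = State (upd (upd R 7 0) 8 r) m t).
Proof.
move=> R1; rewrite /sampw.
set code := [:: SampleBlock 7; _].
suff P n : n <= k -> covers (I := block (n * B))
    (exec (seqs (Assign 8 (Cst 0) :: flatten (nseq n code))) (State R m t))
    (fun r y => exists z, y = State (upd (upd R 7 z) 8 r) m t).
  rewrite -cat_cons exec_cat; apply: covers_bind_det (P k (leqnn k)) _ => r y [z ->].
  have [y' e h] : det [:: Assign 7 (Cst 0)] (State (upd (upd R 7 z) 8 r) m t)
      (fun y => y = State (upd (upd R 7 0) 8 r) m t); last by exists y'.
  apply: (det_assign (v := 0)); [by rewrite ev_cst ?expn_gt0|by rewrite expn_gt0|].
  apply: det_nil; congr State; upd_ext.
elim: n => [_|n IH nk].
  exists (fun=> State (upd (upd R 7 (R 7)) 8 0) m t) => [g|r].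
    rewrite /= /set_reg /= word_small ?expn_gt0 // word_small ?expn_gt0 //=.
    have -> : #|'I_(2 ^ (0 * B))| = 1 by rewrite card_ord.
    have -> : upd R 8 0 = upd (upd R 7 (R 7)) 8 0.
      by upd_ext.
    by rewrite divr1 big_ord1.
  exists (R 7); congr (State (upd _ _ _) _ _).
  by apply/esym/eqP; rewrite -leqn0 -ltnS; exact: ltn_ord r.
have -> : flatten (nseq n.+1 code) = flatten (nseq n code) ++ code.
  by rewrite -[n.+1]addn1 nseqD flatten_cat /= ?cats0.
rewrite -cat_cons exec_cat.
have abW (a : block (n * B)) (b : block B) : a * 2 ^ B + b < W.
  apply: (@leq_trans (2 ^ (n.+1 * B))); last by rewrite leq_exp2l // leq_mul2r nk orbT.
  rewrite mulSn expnD; have := ltn_ord a; have := ltn_ord b.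
  move: (2 ^ B) (2 ^ (n * B)) (nat_of_ord a) (nat_of_ord b) => p q u v; nia.
have H := covers_bind (f := exec (seqs code)) (J := block B)
  (R := fun (a : block (n * B)) (b : block B) y =>
   exists z, y = State (upd (upd R 7 z) 8 (a * 2 ^ B + b)) m t) (IH (ltnW nk)).
apply: covers_impl (covers_reindex (split_word_bij n) (H _)) _.
  move=> a y [z ->]; pose st1 := State (upd (upd R 7 z) 8 (nat_of_ord a)) m t.
  rewrite -[exec _ _]/(obind (exec (SampleBlock 7) st1) (exec (seqs (behead code)))).
  apply: (covers_bind_det (Q := fun (b : block B) y =>
    y = set_reg k st1 7 (nat_of_ord b))).
    by apply: (@covers_uniform _ (dummy B) _ (fun x : block B => set_reg k _ 7 x)).
  move=> b _ ->; rewrite /set_reg word_small ?digit_lt_W //.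
  apply: (det_assign (cs := [::]) (v := a * 2 ^ B + b)) => //.
    apply: (ev_bin (o := OpAdd)) => //.
    by apply: (ev_bin (o := OpShl)) => //; apply: leq_ltn_trans (abW a b); rewrite leq_addr.
  by apply: det_nil; exists b; rewrite /st1 /=; congr State; upd_ext.
move=> r y [z ->]; exists z; congr (State (upd _ _ _) _ _).
rewrite /= [(r %/ _) %% _]modn_small -?divn_eq //.
by rewrite ltn_divLR ?expn_gt0 // -expnD addnC -mulSn.
Qed.

Lemma covers_sample R m t r e n : eval k B R e = n.+1 -> n.+1 < W ->
  n.+1 <= s * N ->
  covers (I := 'I_n.+1) (exec (Sample r e) (State R m t))
    (fun j y => y = State (upd R r j.+1) m t).
Proof.
move=> ev nW nN; rewrite /= ev /= nN.
apply: covers_unif => j; rewrite /set_reg word_small //.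
by apply: leq_ltn_trans nW; have := ltn_ord j.
Qed.

Lemma covers_sample_block R m t r :
  covers (I := block B) (exec (SampleBlock r) (State R m t))
    (fun x y => y = State (upd R r x) m t).
Proof.
apply: (@covers_uniform _ (dummy B) _ (fun x : block B => set_reg k _ r x)) => x.
by rewrite /set_reg word_small ?digit_lt_W.
Qed.

End Machine.

(** * Fisher-Yates shuffling *)

Definition fytape (n : nat) : finType := tape (fun t => 'I_t.+1) n.

(* The inside-out variant: entry m is drawn from the first m + 1 positions. *)
Fixpoint fyseq (n : nat) : fytape n -> seq nat :=
  if n is m.+1 return fytape n -> seq nat then
    fun w => let u := fyseq w.1 in set_nth 0 (rcons u (nth 0 u w.2)) w.2 m
  else fun=> [::].

Lemma size_fyseq n (w : fytape n) : size (fyseq w) = n.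
Proof.
elim: n w => //= n IH [w j] /=; rewrite size_set_nth size_rcons IH.
by apply/maxn_idPr; exact: ltn_ord.
Qed.

Lemma nth_fyseqS n (w : fytape n) (j : 'I_n.+1) e :
  nth 0 (@fyseq n.+1 (w, j)) e =
  if e == j then n else if e == n then nth 0 (fyseq w) j else nth 0 (fyseq w) e.
Proof.
rewrite /= nth_set_nth /=; case: eqP => // _; rewrite nth_rcons size_fyseq.
by case: ltngtP => // h; rewrite nth_default // size_fyseq ltnW.
Qed.

Lemma fyseq_lt n (w : fytape n) e : e < n -> nth 0 (fyseq w) e < n.
Proof.
elim: n w e => // n IH [w j] e en; rewrite nth_fyseqS.
case: eqP => // ej; case: eqP => [en'|en'].
  by apply/leqW/IH; have := ltn_ord j; move: ej; rewrite en'; lia.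
by apply/leqW/IH; lia.
Qed.

Lemma fyseq_inj_nth n (w : fytape n) e e' : e < n -> e' < n ->
  nth 0 (fyseq w) e = nth 0 (fyseq w) e' -> e = e'.
Proof.
elim: n w e e' => // n IH [w j] e e' en e'n; rewrite !nth_fyseqS.
have jn := ltn_ord j.
have [lj le le'] := And3 (@fyseq_lt n w j) (@fyseq_lt n w e) (@fyseq_lt n w e').
have [Ij Ie I] := And3 (IH w j e') (IH w e j) (IH w e e').
by case: eqP => ej; case: eqP => e'j; do ? case: eqP => ?; lia.
Qed.

(** The last draw is readable in the result as the position of the largest value; undoing that step
    leaves the sequence of the previous draws. *)
Lemma fyseq_inj n : injective (@fyseq n).
Proof.
elim: n => [[] []//|n IH [w j] [w' j'] E].
have nthE e : nth 0 (@fyseq n.+1 (w, j)) e = nth 0 (@fyseq n.+1 (w', j')) e by rewrite E.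
have jj : j = j'.
  apply: ord_inj; apply: (@fyseq_inj_nth n.+1 (w', j')) => //; rewrite -nthE.
  by rewrite !nth_fyseqS !eqxx.
subst j'; congr pair; apply: IH; apply: (@eq_from_nth _ 0); rewrite !size_fyseq // => e en.
have [ej|ej] := eqVneq e j.
  have := nthE n; rewrite !nth_fyseqS eqxx -ej.
  by case: eqP => // en'; lia.
by have := nthE e; rewrite !nth_fyseqS (negbTE ej); case: eqP => // ?; lia.
Qed.

Lemma card_fytape n : #|fytape n| = n`!.
Proof.
by elim: n => [|n IH]; rewrite ?card_unit // /fytape /= card_prod -/(fytape n) IH card_ord mulnC.
Qed.

(** No inverse shuffle is constructed: there are as many tapes as permutations, and the map from
    tapes to permutations is injective. *)
Lemma fisher_yates n : exists2 h : 'S_n -> fytape n, bijective h &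
  forall s (i : 'I_n), nth 0 (fyseq (h s)) i = s i.
Proof.
pose f w (i : 'I_n) : 'I_n := Ordinal (fyseq_lt w (ltn_ord i)).
have f_inj w : injective (f w).
  by move=> i j [] /(fyseq_inj_nth (ltn_ord i) (ltn_ord j)) /ord_inj.
pose g w := perm (@f_inj w).
have gE w (i : 'I_n) : g w i = nth 0 (fyseq w) i :> nat by rewrite permE.
have [h gK hK] : bijective g.
  apply: inj_card_bij => [w w' E|]; last by rewrite card_Sn card_fytape.
  apply: fyseq_inj; apply: (@eq_from_nth _ 0); rewrite !size_fyseq // => e en.
  by rewrite -(gE w (Ordinal en)) -(gE w' (Ordinal en)) E.
by exists h => [|s i]; [exists g|rewrite -gE hK].
Qed.

(** * Two interleaved linked lists *)

(* The nodes 0, ..., M-1 are distributed by [c] over two linked lists; the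
   list of class b is closed by a sentinel. *)
Section Lists.
Variables (M : nat) (c : nat -> bool) (le : rel nat).

Definition sentinel (b : bool) : nat := if b then M else M.+1.

Definition class_from (b : bool) (i : nat) : seq nat :=
  [seq j <- iota i (M - i) | c j == b].

Definition first_from (b : bool) (i : nat) : nat := head (sentinel b) (class_from b i).

Definition succ_node (i : nat) : nat := if i < M then first_from (c i) i.+1 else i.

Lemma class_from_ge b i : M <= i -> class_from b i = [::].
Proof. by rewrite /class_from -subn_eq0 => /eqP ->. Qed.

Lemma class_fromS b i : i < M ->
  class_from b i = if c i == b then i :: class_from b i.+1 else class_from b i.+1.
Proof. by move=> iM; rewrite /class_from -(subnSK iM). Qed.

Lemma class_from_cons b i x l : class_from b i = x :: l ->
  [/\ x < M, c x = b & l = class_from b x.+1].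
Proof.
have [n e] : exists n, M - i = n by exists (M - i).
elim: n i e => [|n IH] i e.
  by rewrite class_from_ge // -subn_eq0 e.
have iM : i < M by lia.
rewrite class_fromS //; case: eqP => [ci [<- <-]|_]; first by [].
by apply: IH; lia.
Qed.

Lemma first_from_bounds b i : i <= M -> i <= first_from b i < M.+2.
Proof.
move=> iM; rewrite /first_from; case e : (class_from b i) => [|x l] /=.
  by rewrite /sentinel; case: b {e}; lia.
have : x \in class_from b i by rewrite e mem_head.
by rewrite mem_filter mem_iota => /andP[_]; lia.
Qed.

Lemma first_from_lt b i : first_from b i < M.+2.
Proof.
have [iM|Mi] := leqP i M; first by case/andP: (first_from_bounds b iM).
rewrite /first_from class_from_ge ?(ltnW Mi) // /sentinel /=.
by case: b; rewrite ltnS ?leqnSn.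
Qed.

Lemma succ_node_lt i : i < M.+2 -> succ_node i < M.+2.
Proof. by move=> iL; rewrite /succ_node; case: ifP => // _; apply: first_from_lt. Qed.

Lemma first_fromS b i : i < M ->
  first_from b i = if c i == b then i else first_from b i.+1.
Proof. by move=> iM; rewrite /first_from class_fromS //; case: ifP. Qed.

Lemma first_from_ge b i : M <= i -> first_from b i = sentinel b.
Proof. by move=> Mi; rewrite /first_from class_from_ge. Qed.

(** The client knows nodes by their hidden locations only; a pointer to itself is how it recognizes
    the end of a list. *)
Lemma succ_node_eq i : i < M.+2 -> (succ_node i == i) = (M <= i).
Proof.
rewrite /succ_node; case: (ltnP i M) => [iM _|]; last by rewrite eqxx.
by have := first_from_bounds (c i) iM; lia.
Qed.

Definition merged_nodes : seq nat := merge le (class_from true 0) (class_from false 0).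

(** The order of the fetches: both heads first, then each popped node is replaced by its successor
    in the same list. *)
Definition visits : seq nat :=
  [:: first_from true 0, first_from false 0 & map succ_node merged_nodes].

Lemma perm_classes : perm_eq (class_from true 0 ++ class_from false 0) (iota 0 M).
Proof.
rewrite /class_from subn0.
rewrite (eq_filter (a2 := c)); last by move=> i; case: (c i).
rewrite [X in _ ++ X](eq_filter (a2 := predC c)); last by move=> i /=; case: (c i).
by rewrite perm_filterC.
Qed.

Lemma perm_merged_nodes : perm_eq merged_nodes (iota 0 M).
Proof. by apply: perm_trans perm_classes; rewrite perm_merge. Qed.

Lemma size_merged_nodes : size merged_nodes = M.
Proof. by rewrite (perm_size perm_merged_nodes) size_iota. Qed.

Lemma map_succ_class b i :
  first_from b i :: map succ_node (class_from b i) = rcons (class_from b i) (sentinel b).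
Proof.
rewrite /first_from.
have [l e] : exists l, class_from b i = l by exists (class_from b i).
rewrite e; elim: l i e => [|x l IH] i e //.
have [xM cx el] := class_from_cons e.
rewrite /= {1}/succ_node xM cx /first_from -el; congr (_ :: _).
by apply: (IH x.+1); rewrite el.
Qed.

(** By [map_succ_class], the head of a list and the successors of its members are together its
    members and its sentinel. This is what makes the visiting order a permutation of all nodes. *)
Lemma perm_visits : perm_eq visits (iota 0 M.+2).
Proof.
have e : perm_eq (map succ_node merged_nodes)
    (map succ_node (class_from true 0) ++ map succ_node (class_from false 0)).
  by rewrite -map_cat; apply: perm_map; rewrite perm_merge.
have mc b := map_succ_class b 0.
apply/seq.permP => p; move/seq.permP: e => /(_ p); move/seq.permP: perm_classes => /(_ p).
have := congr1 (count p) (mc true); have := congr1 (count p) (mc false).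
rewrite -[M.+2]addn2 iotaD add0n /visits /sentinel /= -!cats1 !count_cat /=; lia.
Qed.

Definition pop_first (h1 h2 : nat) : bool := (h1 < M) && ((M <= h2) || le h1 h2).

(** The remaining output is the merge of two suffixes, described by lower bounds [i1] and [i2]
    instead of their heads: this stays meaningful when a list is exhausted and its head is the
    sentinel. *)
Lemma merge_step i1 i2 :
  let h1 := first_from true i1 in let h2 := first_from false i2 in
  let l := merge le (class_from true i1) (class_from false i2) in
  let b := pop_first h1 h2 in
  0 < size l ->
  [/\ head 0 l = (if b then h1 else h2),
      behead l = (if b then merge le (class_from true h1.+1) (class_from false i2)
                  else merge le (class_from true i1) (class_from false h2.+1)),
      head 0 l < M,
      b -> succ_node h1 = first_from true h1.+1
    & ~~ b -> succ_node h2 = first_from false h2.+1].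
Proof.
rewrite /pop_first /first_from /=.
case e1 : (class_from true i1) => [|x1 l1]; case e2 : (class_from false i2) => [|x2 l2] //=.
- have [xM cx ->] := class_from_cons e2 => _; rewrite ltnn /=.
  by split=> //; rewrite /succ_node xM cx.
- have [xM cx ->] := class_from_cons e1 => _; rewrite leqnSn xM /=.
  split=> //; first by case: (class_from _ _).
  by rewrite /succ_node xM cx.
have [x1M c1 E1] := class_from_cons e1; have [x2M c2 E2] := class_from_cons e2.
move=> _; rewrite x1M leqNgt x2M /=; case: ifP => _ /=; split=> //.
- by rewrite E1 -?e2.
- by rewrite /succ_node x1M c1.
- by rewrite -E2.
- by rewrite /succ_node x2M c2.
Qed.

End Lists.

(** * The protocol *)

Notation sv0 := (0%R : 'Z_3).
Notation sv1 := (1%R : 'Z_3).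
Notation sv2 := (2%R : 'Z_3).

(** The body is split into [c0], which draws all the coins of an iteration, and the deterministic
    rest [cs], to which [det] applies. *)
Definition for_loop (bound : expr) (c0 : cmd) (cs : seq cmd) : cmd := seqs
  [:: Assign 5 (Cst 0);
      While (Bin OpLt (Reg 5) bound)
        (seqs (c0 :: cs ++ [:: Assign 5 (Bin OpAdd (Reg 5) (Cst 1))]))].

(* Registers: 3 and 4 hold the numbers M and L = M + 2 of items and of nodes, 5 is
   the loop counter; 14 and 15 point to the heads of the two lists, 16, 17 and
   18, 19 hold the block of each head and the pointer to its successor.
   Areas: server 2 has the permutations p1 and p2 in areas 2 and 3.  Node i is
   stored at p1 i in area 4 (pad on server 1, padded node on server 2), and then
   with a new pad at p2 (p1 i) in area 5 (pad on server 0, padded node on server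
   2, copied to server 1). *)
Definition shuffle (k c : nat) : cmd := for_loop (Reg 4)
  (Sample 9 (Bin OpAdd (Reg 5) (Cst 1)))
  [:: Assign 9 (Bin OpSub (Reg 9) (Cst 1));
      rdw k sv2 (area_word c (Reg 9));
      Assign 10 (Reg 8);
      wrw k sv2 (area_word c (Reg 5)) (Reg 10);
      wrw k sv2 (area_word c (Reg 9)) (Reg 5)].

Definition notE (e : expr) : expr := Bin OpEq e (Cst 0).
Definition halfE : expr := Bin OpShl (Cst 1) (Bin OpSub (Reg 1) (Cst 1)).

(* For merging, the input of server j is X_j, X_(j+1), Y_j, Y_(j+1).  At the two
   sentinels this address yields junk, which is never output. *)
Definition item_addr (mrg : bool) : expr :=
  if mrg then Bin OpAdd (Reg 9) (Bin OpMul (notE (Bin OpLt (Reg 9) (Reg 0))) (Reg 0))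
  else Reg 9.

Definition item_class (mrg : bool) : expr :=
  if mrg then Bin OpLt (Reg 9) (Reg 0) else notE (Bin OpLt (Reg 10) halfE).

(* Nodes are linked from the last one to the first; i >= M for sentinels, which
   point to themselves. *)
Definition link_node (mrg : bool) : cmd :=
  If (Bin OpLt (Reg 9) (Reg 3))
    (seqs [:: If (item_class mrg)
                (seqs [:: Assign 13 (Reg 14); Assign 14 (Reg 12)])
                (seqs [:: Assign 13 (Reg 15); Assign 15 (Reg 12)])])
    (seqs [:: Assign 13 (Reg 12);
              If (Bin OpEq (Reg 9) (Reg 3))
                (seqs [:: Assign 14 (Reg 12)])
                (seqs [:: Assign 15 (Reg 12)])]).

(** A node is written once, so the location of its successor has to be known by then. Going
    downwards, two registers suffice for that: they hold the heads of the lists built so far. *)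
Definition build (mrg : bool) (k : nat) : cmd := for_loop (Reg 4)
  (sampw k)
  [:: Assign 16 (Reg 8);
      Assign 9 (Bin OpSub (Bin OpSub (Reg 4) (Cst 1)) (Reg 5));
      Read sv0 10 (item_addr mrg);
      Read sv1 11 (item_addr mrg);
      Read sv2 12 (item_addr mrg);
      Assign 10 (Bin OpXor (Bin OpXor (Reg 10) (Reg 11)) (Reg 12));
      rdw k sv2 (area_word 2 (Reg 9));
      Assign 11 (Reg 8);
      rdw k sv2 (area_word 3 (Reg 11));
      Assign 12 (Reg 8);
      link_node mrg;
      wrw k sv1 (area_word 4 (Reg 11)) (Reg 16);
      wrw k sv2 (area_word 4 (Reg 11))
        (Bin OpXor (Bin OpAdd (Reg 10) (Bin OpShl (Reg 13) (Reg 1))) (Reg 16))].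

Definition reshuffle (k : nat) : cmd := for_loop (Reg 4)
  (sampw k)
  [:: Assign 11 (Reg 8);
      rdw k sv1 (area_word 4 (Reg 5));
      Assign 9 (Reg 8);
      rdw k sv2 (area_word 4 (Reg 5));
      Assign 9 (Bin OpXor (Reg 9) (Reg 8));
      rdw k sv2 (area_word 3 (Reg 5));
      Assign 10 (Reg 8);
      wrw k sv0 (area_word 5 (Reg 10)) (Reg 11);
      wrw k sv2 (area_word 5 (Reg 10)) (Bin OpXor (Reg 9) (Reg 11))].

Definition copy (k : nat) : cmd := for_loop (Reg 4) Skip
  [:: rdw k sv2 (area_word 5 (Reg 5));
      Assign 9 (Reg 8);
      wrw k sv1 (area_word 5 (Reg 5)) (Reg 9)].

Definition fetch (k r : nat) : cmd := seqs
  [:: rdw k sv0 (area_word 5 (Reg r));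
      Assign 9 (Reg 8);
      rdw k sv1 (area_word 5 (Reg r));
      Assign 9 (Bin OpXor (Reg 9) (Reg 8));
      Assign 10 (Bin OpMod (Reg 9) (Bin OpShl (Cst 1) (Reg 1)));
      Assign 11 (Bin OpShr (Reg 9) (Reg 1))].

Definition laddrE (r : nat) : expr :=
  Bin OpDiv (Bin OpMod (Reg r) halfE)
    (Bin OpShl (Cst 1) (Bin OpSub (Bin OpSub (Reg 1) (Cst 1)) (Reg 2))).

(** [block_le] with a sum for the disjunction and a product for the conjunction. The sum may be 2,
    so [pop_firstE] compares it with 0. *)
Definition leE : expr :=
  Bin OpAdd (Bin OpLt (Reg 18) halfE)
    (Bin OpMul (notE (Bin OpLt (Reg 16) halfE))
               (notE (Bin OpLt (laddrE 18) (laddrE 16)))).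

Definition pop_firstE : expr :=
  Bin OpMul (notE (Bin OpEq (Reg 17) (Reg 14)))
    (Bin OpLt (Cst 0) (Bin OpAdd (Bin OpEq (Reg 19) (Reg 15)) leE)).

(** Registers 12 and 13 hold the output shares 0 and 1 of one entry, and register 23 share 2. The
    output overwrites the input, which [build] has already read. *)
Definition traverse (k : nat) : cmd := for_loop (Reg 3)
  (seqs [:: SampleBlock 12; SampleBlock 13])
  [:: Assign 20 pop_firstE;
      If (Reg 20)
        (seqs [:: Assign 21 (Reg 16); Assign 14 (Reg 17); Assign 22 (Reg 17)])
        (seqs [:: Assign 21 (Reg 18); Assign 15 (Reg 19); Assign 22 (Reg 19)]);
      fetch k 22;
      If (Reg 20)
        (seqs [:: Assign 16 (Reg 10); Assign 17 (Reg 11)])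
        (seqs [:: Assign 18 (Reg 10); Assign 19 (Reg 11)]);
      Assign 23 (Bin OpXor (Reg 21) (Bin OpXor (Reg 12) (Reg 13)));
      Write sv0 (Reg 5) (Reg 12);
      Write sv0 (Bin OpAdd (Reg 3) (Reg 5)) (Reg 13);
      Write sv1 (Reg 5) (Reg 13);
      Write sv1 (Bin OpAdd (Reg 3) (Reg 5)) (Reg 23);
      Write sv2 (Reg 5) (Reg 23);
      Write sv2 (Bin OpAdd (Reg 3) (Reg 5)) (Reg 12)].

Definition prepare (mrg : bool) : seq cmd :=
  [:: Assign 3 (if mrg then Bin OpAdd (Reg 0) (Reg 0) else Reg 0);
      Assign 4 (Bin OpAdd (Reg 3) (Cst 2))].

Definition fetch_heads (k : nat) : seq cmd :=
  [:: fetch k 14; Assign 16 (Reg 10); Assign 17 (Reg 11);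
      fetch k 15; Assign 18 (Reg 10); Assign 19 (Reg 11)].

(** The sample range 4 suffices: [Sample] is used with at most [M + 2] values, which is at most
    [4 * N] for positive [N]. *)
Definition list_protocol (mrg : bool) (k : nat) : protocol :=
  Protocol k 4 (seqs
    [:: seqs (prepare mrg); shuffle k 2; shuffle k 3; build mrg k;
        reshuffle k; copy k; seqs (fetch_heads k); traverse k]).

Fixpoint tape_events (J : nat -> finType) (ev : forall t, tape J t -> J t -> seq event)
    n : tape J n -> seq event :=
  if n is m.+1 return tape J n -> seq event then
    fun w => tape_events ev w.1 ++ ev m w.1 w.2
  else fun=> [::].

Fixpoint lookup (J : finType) (j0 : J) n : tape (fun=> J) n -> nat -> J :=
  if n is m.+1 return tape (fun=> J) n -> nat -> J then
    fun w i => if i == m then w.2 else lookup j0 w.1 i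
  else fun _ _ => j0.

Arguments seqs : simpl never.
Arguments eval : simpl never.
Arguments xorb_block : simpl never.
Arguments to_block : simpl never.

(** * Symbolic evaluation of the expressions of the client *)

Section Evaluation.
Variables (k B : nat) (R : nat -> nat) (e1 e2 : expr) (v1 v2 : nat).
Hypotheses (h1 : eval k B R e1 = v1) (h2 : eval k B R e2 = v2).

Lemma ev_add : v1 + v2 < 2 ^ (k * B) -> eval k B R (Bin OpAdd e1 e2) = v1 + v2.
Proof. exact: (ev_bin (o := OpAdd)). Qed.

Lemma ev_sub : v1 - v2 < 2 ^ (k * B) -> eval k B R (Bin OpSub e1 e2) = v1 - v2.
Proof. exact: (ev_bin (o := OpSub)). Qed.

Lemma ev_mul : v1 * v2 < 2 ^ (k * B) -> eval k B R (Bin OpMul e1 e2) = v1 * v2.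
Proof. exact: (ev_bin (o := OpMul)). Qed.

Lemma ev_div : v1 %/ v2 < 2 ^ (k * B) -> eval k B R (Bin OpDiv e1 e2) = v1 %/ v2.
Proof. exact: (ev_bin (o := OpDiv)). Qed.

Lemma ev_mod : v1 %% v2 < 2 ^ (k * B) -> eval k B R (Bin OpMod e1 e2) = v1 %% v2.
Proof. exact: (ev_bin (o := OpMod)). Qed.

Lemma ev_shl : v1 * 2 ^ v2 < 2 ^ (k * B) -> eval k B R (Bin OpShl e1 e2) = v1 * 2 ^ v2.
Proof. exact: (ev_bin (o := OpShl)). Qed.

Lemma ev_shr : v1 %/ 2 ^ v2 < 2 ^ (k * B) -> eval k B R (Bin OpShr e1 e2) = v1 %/ 2 ^ v2.
Proof. exact: (ev_bin (o := OpShr)). Qed.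

Lemma ev_eq : nat_of_bool (v1 == v2) < 2 ^ (k * B) ->
  eval k B R (Bin OpEq e1 e2) = nat_of_bool (v1 == v2).
Proof. exact: (ev_bin (o := OpEq)). Qed.

Lemma ev_lt : nat_of_bool (v1 < v2) < 2 ^ (k * B) ->
  eval k B R (Bin OpLt e1 e2) = nat_of_bool (v1 < v2).
Proof. exact: (ev_bin (o := OpLt)). Qed.

End Evaluation.

Ltac reg := rewrite /upd /=; first [eassumption | reflexivity].
Ltac bnd := first [assumption | lia].
Ltac ev := first [eassumption | lazymatch goal with
  | |- eval _ _ _ (Cst _) = _ => apply: ev_cst; bnd
  | |- eval _ _ _ (area_word _ _) = _ => rewrite /area_word; ev
  | |- eval _ _ _ (notE _) = _ => rewrite /notE; ev
  | |- eval _ _ _ halfE = _ => rewrite /halfE; ev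
  | |- eval _ _ _ (laddrE _) = _ => rewrite /laddrE; ev
  | |- eval _ _ _ (Reg _) = _ => apply: ev_reg; reg
  | |- eval _ _ _ (Bin OpAdd _ _) = _ => apply: ev_add; [ev|ev|bnd]
  | |- eval _ _ _ (Bin OpSub _ _) = _ => apply: ev_sub; [ev|ev|bnd]
  | |- eval _ _ _ (Bin OpMul _ _) = _ => apply: ev_mul; [ev|ev|bnd]
  | |- eval _ _ _ (Bin OpDiv _ _) = _ => apply: ev_div; [ev|ev|bnd]
  | |- eval _ _ _ (Bin OpMod _ _) = _ => apply: ev_mod; [ev|ev|bnd]
  | |- eval _ _ _ (Bin OpShl _ _) = _ => apply: ev_shl; [ev|ev|bnd]
  | |- eval _ _ _ (Bin OpShr _ _) = _ => apply: ev_shr; [ev|ev|bnd]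
  | |- eval _ _ _ (Bin OpEq _ _) = _ => apply: ev_eq; [ev|ev|bnd]
  | |- eval _ _ _ (Bin OpLt _ _) = _ => apply: ev_lt; [ev|ev|bnd]
  end].
Ltac evto := first [solve [ev] | eapply etrans; [ev | try lia]].

Definition nitems (mrg : bool) (N : nat) : nat := if mrg then N + N else N.

(** * Correctness of the phases *)

Section Phases.
Variables (mrg : bool) (k N B aw fuel : nat).
Local Notation M := (nitems mrg N).
Local Notation L := M.+2.
Local Notation W := (2 ^ (k * B)).
Local Notation exec := (exec k 4 N fuel).
Local Notation det := (det k 4 N fuel).
Hypothesis k_gt0 : 0 < k.
Hypothesis B_gt0 : 0 < B.
Hypothesis N_gt0 : 0 < N.
Hypothesis awB : aw < B.
(** A server uses six areas of [L] words of [k] cells. The slack [8 * L] leaves room for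
    intermediate values such as the addresses of items. *)
Hypothesis addrW : 6 * L * k + 8 * L <= W.
Hypothesis nodeW : L * 2 ^ B <= W.
Hypothesis fuelL : L <= fuel.
Implicit Types (st y : state B) (R : nat -> nat) (m : 'Z_3 -> nat -> block B).

Definition public R : Prop := [/\ R 0 = N, R 1 = B, R 2 = aw, R 3 = M & R 4 = L].

Lemma covers_for n J bnd c0 cs (Inv : forall t, tape J t -> state B -> Prop) st :
  n <= L ->
  (forall t w y, Inv t w y -> regs y 5 = t /\ eval k B (regs y) bnd = n) ->
  (forall t w y, t < n -> Inv t w y ->
     exists2 Q : J t -> state B -> Prop, covers (exec c0 y) Q &
     forall j z, Q j z -> det cs z (fun y' => regs y' 5 = t /\
       Inv t.+1 (w, j) (State (upd (regs y') 5 t.+1) (memory y') (trace y')))) ->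
  Inv 0 tt (State (upd (regs st) 5 0) (memory st) (trace st)) ->
  covers (exec (for_loop bnd c0 cs) st) (Inv n).
Proof.
move=> nL hreg hstep h0.
have nW : n < W by move: (2 ^ (k * B)) addrW => x; lia.
have -> : exec (for_loop bnd c0 cs) st = exec (seqs (behead
  [:: Assign 5 (Cst 0);
      While (Bin OpLt (Reg 5) bnd)
        (seqs (c0 :: cs ++ [:: Assign 5 (Bin OpAdd (Reg 5) (Cst 1))]))]))
    (State (upd (regs st) 5 0) (memory st) (trace st)).
  rewrite /seqs /= /set_reg /eval /=.
  by rewrite !(@word_small k B 0) ?expn_gt0.
apply: (covers_bind_det (Q := Inv n)); last by move=> i x hx; exists x.
apply: (covers_while (Inv := Inv)) => //; first exact: leq_trans fuelL.
  move=> w y /hreg [e5 eb].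
  rewrite (ev_bin (o := OpLt) (ev_reg _ _ e5) eb) /= ltnn //.
  exact: leq_ltn_trans nW.
move=> t w y tn hy; have [e5 eb] := hreg _ _ _ hy; split.
  rewrite (ev_bin (o := OpLt) (ev_reg _ _ e5) eb) /= tn //.
  by apply: (leq_ltn_trans _ nW); apply: leq_ltn_trans tn.
have [Q hQ hd] := hstep _ _ _ tn hy.
apply: (covers_bind_det hQ) => j z hz.
suff [y' e h] : det (cs ++ [:: Assign 5 (Bin OpAdd (Reg 5) (Cst 1))]) z (Inv t.+1 (w, j)).
  by exists y'.
apply: det_cat; apply: det_impl (hd _ _ hz) _ => -[R' m' t'] /= [e5' hI].
have tW : t.+1 < W by apply: leq_ltn_trans nW.
apply: (det_assign (v := t.+1)) => //; last exact: det_nil.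
rewrite -[t.+1]addn1; apply: (ev_bin (o := OpAdd)); first exact: ev_reg.
  by apply: ev_cst; apply: leq_ltn_trans tW.
by rewrite /= addn1.
Qed.


(** [P] marks the words that may change. The cells of areas 0 and 1 are addressed one by one, hence
    framed separately, and no phase using this notion modifies them. *)
Definition frame (y0 y : state B) (P : 'Z_3 -> nat -> bool) : Prop :=
  (forall j A, ~~ P j A -> getw k (memory y j) A = getw k (memory y0 j) A) /\
  (forall j a, a < 2 * L * k -> memory y j a = memory y0 j a).

Lemma getw_updm m j j' A A' V : V < W ->
  getw k (updm m j (fun f => updw k f A V) j') A' =
  if (j' == j) && (A' == A) then V else getw k (m j') A'.
Proof. by move=> VW; rewrite /updm; case: (j' == j) => //=; apply: getw_updw. Qed.

Lemma updm_low m j j' A V a : a < A * k ->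
  updm m j (fun f => updw k f A V) j' a = m j' a.
Proof. by move=> aA; rewrite /updm; case: (j' == j) => //; apply: updw_low. Qed.

Lemma area_eq c c' e e' : e < L -> e' < L ->
  (c * L + e == c' * L + e') = (c == c') && (e == e').
Proof.
move=> eL e'L; apply/eqP/andP => [E|[/eqP -> /eqP -> //]].
have ec : c = c'.
  by have := congr1 (divn^~ L) E; rewrite !divnMDl // !divn_small // !addn0.
by move: E; rewrite ec => /addnI ->.
Qed.

Lemma area_addr c e : c <= 5 -> e < L -> (c * L + e) * k + k <= W.
Proof.
move=> c5 eL; apply: leq_trans addrW; apply: (@leq_trans (6 * L * k)); last exact: leq_addr.
rewrite -mulSnr leq_mul2r; apply/orP; right; nia.
Qed.

Lemma area_lt c e : c <= 5 -> e < L -> c * L + e < W.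
Proof. by move=> c5 eL; apply: leq_trans addrW; nia. Qed.

Lemma area_low c e a : 2 <= c -> a < 2 * L * k -> a < (c * L + e) * k.
Proof. by move=> c2 aL; apply: leq_trans aL _; rewrite leq_mul2r; apply/orP; right; nia. Qed.

Definition fy_events (c t : nat) (w : fytape t) (j : 'I_t.+1) : seq event :=
  let v := nth 0 (fyseq w) j in
  [:: Event true false sv2 (c * L + j) v; Event true true sv2 (c * L + t) v;
      Event true true sv2 (c * L + j) t].

(** The area has to start with zeros: if iteration [t] draws position [t], the client reads a cell
    not yet written, which [fyseq] models by the default 0 of [nth], and this value is sent in the
    trace. *)
Lemma covers_shuffle c y0 es0 : 2 <= c <= 5 -> public (regs y0) ->
  trace y0 = expands k B es0 ->
  (forall e, e < L -> getw k (memory y0 sv2) (c * L + e) = 0) ->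
  covers (I := fytape L) (exec (shuffle k c) y0) (fun w y =>
    [/\ public (regs y), trace y = expands k B (es0 ++ tape_events (fy_events c) w),
        forall e, e < L -> getw k (memory y sv2) (c * L + e) = nth 0 (fyseq w) e
      & frame y0 y (fun j A => (j == sv2) && (A %/ L == c))]).
Proof.
case/andP=> c2 c5 pub0 tr0 zero.
pose Inv t (w : fytape t) (y : state B) := regs y 5 = t /\
    [/\ public (regs y), trace y = expands k B (es0 ++ tape_events (fy_events c) w),
        forall e, e < L -> getw k (memory y sv2) (c * L + e) = nth 0 (fyseq w) e
      & frame y0 y (fun j A => (j == sv2) && (A %/ L == c))].
have LW := area_lt c5 (ltn0Sn _ : 0 < L); rewrite addn0 in LW.
have cW : c < W by apply: leq_ltn_trans LW; rewrite leq_pmulr.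
have L0W : L < W by apply: leq_ltn_trans LW; rewrite leq_pmull //; lia.
suff H : covers (exec (shuffle k c) y0) (Inv L).
  by apply: covers_impl H _ => w y [].
apply: covers_for => //.
- by move=> t w y [e5 [[_ _ _ _ e4] _ _ _]]; split=> //; apply: ev_reg.
- move=> t w [R m tr] tL [/= e5 [[e0 e1 e2 e3 e4] etr mem [fr1 fr2]]].
  exists (fun (j : 'I_t.+1) z => z = State (upd R 9 j.+1) m tr).
    apply: (@covers_sample k 4 B N fuel R m tr 9 (Bin OpAdd (Reg 5) (Cst 1)) t); [evto|lia|].
    by apply: leq_trans tL _; rewrite /nitems; case: (mrg); lia.
  move=> j _ ->.
  have jL : j < L by apply: leq_trans tL; rewrite ltnS; have := ltn_ord j; lia.
  have jW := area_lt c5 jL; have tW := area_lt c5 tL.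
  apply: (det_assign (v := j)); [evto|lia|].
  apply: (det_rdw k_gt0 B_gt0 (A := c * L + j)); [reg|ev|exact: area_addr|].
  have vW : nth 0 (fyseq w) j < W by rewrite -mem //; apply: getw_lt.
  rewrite mem //; move: vW; set v := nth 0 (fyseq w) j => vW.
  apply: (det_assign (v := v)); [by ev|by []|].
  apply: (det_wrw k_gt0 B_gt0 (A := c * L + t) (V := v)); [reg|ev|by []|ev|exact: area_addr|].
  apply: (det_wrw k_gt0 B_gt0 (A := c * L + j) (V := t)); [reg|ev|lia|ev|exact: area_addr|].
  apply: det_nil; split; first by reg.
  have t0W : t < W by lia.
  split; first by reg.
  split=> [|||/=].
  - by split; reg.
  - by rewrite etr -!expands_rcons -!catA.
  - move=> e eL; rewrite nth_fyseqS /= !getw_updm // eqxx /= !area_eq // eqxx /= mem //.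
  split=> [j' A|j' a aL]; last by rewrite -fr2 //= !updm_low ?area_low.
  rewrite !getw_updm //= => /nandP h; rewrite -fr1; last by apply/nandP.
  case: (eqVneq j' 2%R) h => [_ [//|h]|//] /=.
  do ! case: eqP => [eA|_] //; move: h; rewrite eA divnMDl // divn_small // addn0 eqxx.
    by [].
  by [].
split; first by reg.
split=> //.
- by rewrite /= cats0.
- by move=> e eL; rewrite zero //= nth_nil.
Qed.

Variable inp : 'Z_3 -> seq (block B).

Definition addr (i : nat) : nat := if mrg then i + ~~ (i < N) * N else i.

Definition share (j : 'Z_3) (i : nat) : block B := nth (dummy B) (inp j) (addr i).

Definition item (i : nat) : block B :=
  xorb_block (xorb_block (share sv0 i) (share sv1 i)) (share sv2 i).

Arguments item : simpl never.

Definition nclass (i : nat) : bool := if mrg then i < N else is_real (item i).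

Variables p1 p2 : nat -> nat.
Hypothesis p1_lt : forall i, i < L -> p1 i < L.
Hypothesis p2_lt : forall i, i < L -> p2 i < L.
Hypothesis p1_inj : forall i i', i < L -> i' < L -> p1 i = p1 i' -> i = i'.
Hypothesis p2_inj : forall i i', i < L -> i' < L -> p2 i = p2 i' -> i = i'.

Let rho i := p2 (p1 i).
Local Notation hd := (first_from M nclass).
Local Notation nxt := (succ_node M nclass).

(** A word is viewed as a block of [k * B] bits, so that pads are uniform blocks and the laws of
    [xorb_block] apply. The item occupies the low [B] bits, the location of the successor the
    others. *)
Definition node (i : nat) : block (k * B) :=
  to_block (k * B) (item i + p2 (p1 (nxt i)) * 2 ^ B).

Lemma area_div c e : e < L -> (c * L + e) %/ L = c.
Proof. by move=> eL; rewrite divnMDl // divn_small // addn0. Qed.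

Lemma rho_lt i : i < L -> rho i < L.
Proof. by move=> iL; apply/p2_lt/p1_lt. Qed.

Lemma val_node i : i < L -> node i = item i + rho (nxt i) * 2 ^ B :> nat.
Proof.
move=> iL; rewrite /= /to_block /= modn_small //.
apply: leq_trans nodeW; apply: (@leq_trans ((rho (nxt i)).+1 * 2 ^ B)).
  by rewrite mulSn ltn_add2r; exact: (ltn_ord (item i)).
by rewrite leq_mul2r; apply/orP; right; apply/rho_lt/succ_node_lt.
Qed.

Lemma block_ltW (x : block B) : x < W.
Proof. exact: digit_lt_W. Qed.

Lemma B_ltW : B < W.
Proof. by apply: leq_trans (ltn_expl B (isT : 1 < 2)) _; rewrite leq_exp2l // leq_pmull. Qed.

Lemma pow_leW b : b <= B -> 2 ^ b <= 2 ^ B.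
Proof. by rewrite leq_exp2l. Qed.

Lemma pow_ltW : 2 ^ B < W.
Proof. by apply: leq_trans nodeW; rewrite ltn_Pmull // expn_gt0. Qed.

Lemma half_ltW : 2 ^ (B - 1) < W.
Proof. by apply: leq_ltn_trans pow_ltW; apply: pow_leW; apply: leq_subr. Qed.

Lemma item_le : N <= M.
Proof. by rewrite /nitems; case: (mrg); rewrite ?leq_addr. Qed.

Lemma addr_lt i : i < L -> addr i < 2 * L.
Proof.
move: item_le; move: (nitems mrg N) => m; rewrite /addr.
by case: (mrg); [case: (i < N) => /=; lia|lia].
Qed.

Lemma addr_low i : i < L -> addr i < 2 * L * k.
Proof. by move/addr_lt => h; apply: leq_trans h _; rewrite leq_pmulr. Qed.

Lemma L_ltW : 8 * L <= W.
Proof. by apply: leq_trans addrW; rewrite leq_addl. Qed.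

Lemma ev_item_addr R i : public R -> R 9 = i -> i < L ->
  eval k B R (item_addr mrg) = addr i.
Proof.
move=> [e0 e1 e2 e3 e4] e9 iL.
have iNW : i + N < W by have := L_ltW; have := item_le; lia.
rewrite /item_addr /addr; case: (mrg); last by ev.
eapply etrans; first by ev.
by rewrite /= eqb0.
Qed.

Lemma ev_item_class R i : public R -> R 9 = i -> R 10 = item i -> i < L ->
  eval k B R (item_class mrg) = nclass i.
Proof.
move=> [e0 e1 e2 e3 e4] e9 e10 iL.
have LW := L_ltW; have hW := half_ltW; have bW := B_ltW.
rewrite /item_class /nclass; case: (mrg); first by ev.
eapply etrans; first by ev.
by rewrite /= eqb0 -leqNgt /is_real mul1n subn1.
Qed.

(** Registers 14 and 15 hold the locations of the current heads. Going down from [M.+1], the list of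
    class [false] exists after the first node, that of class [true] only once its sentinel [M] has
    been reached; hence the guards on [i]. *)
Lemma det_link i R m t cs Q : i < L -> public R ->
  R 9 = i -> R 10 = item i -> R 12 = rho i ->
  (i < M -> R 14 = rho (hd true i.+1)) -> (i < M.+1 -> R 15 = rho (hd false i.+1)) ->
  (forall R', (forall r, r < 13 -> R' r = R r) -> R' 16 = R 16 -> R' 5 = R 5 ->
     R' 13 = rho (nxt i) ->
     (i <= M -> R' 14 = rho (hd true i)) -> R' 15 = rho (hd false i) ->
     det cs (State R' m t) Q) ->
  det (link_node mrg :: cs) (State R m t) Q.
Proof.
move=> iL pub e9 e10 e12 e14 e15 H; have [e0 e1 e2 e3 e4] := pub.
have LW := L_ltW.
have rW j : j < L -> rho j < W by move/rho_lt; lia.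
have r12W := rW _ iL.
apply: (det_if (v := (i < M))); first by ev.
case: (ltnP i M) => iM /=.
  have {}e14 := e14 iM; have {}e15 := e15 (ltnW iM).
  have r14W := rW _ (first_from_lt M nclass true i.+1).
  have r15W := rW _ (first_from_lt M nclass false i.+1).
  apply: (det_if (v := nclass i)); first exact: ev_item_class.
  have nE : nxt i = hd (nclass i) i.+1 by rewrite /succ_node iM.
  have h1 := first_fromS nclass true iM; have h2 := first_fromS nclass false iM.
  case ci : (nclass i) h1 h2 nE => /= h1 h2 nE.
    apply: (det_assign (v := rho (hd true i.+1))); [by ev|by []|].
    apply: (det_assign (v := rho i)); [by ev|by []|].
    apply: H; rewrite ?h1 ?h2 ?nE //.
    by move=> r r13; rewrite /upd; do 2 (case: eqP => [?|_]; first by lia).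
  apply: (det_assign (v := rho (hd false i.+1))); [by ev|by []|].
  apply: (det_assign (v := rho i)); [by ev|by []|].
  apply: H; rewrite ?h1 ?h2 ?nE //.
  by move=> r r13; rewrite /upd; do 2 (case: eqP => [?|_]; first by lia).
have nE : nxt i = i by rewrite /succ_node ltnNge iM.
have h1 := first_from_ge nclass true iM; have h2 := first_from_ge nclass false iM.
apply: (det_assign (v := rho i)); [by ev|by []|].
apply: (det_if (v := (i == M))); first by ev.
case: (eqVneq i M) => iM' /=.
  apply: (det_assign (v := rho i)); [by ev|by []|].
  apply: H; rewrite ?h1 ?h2 ?nE //.
  - by move=> r r13; rewrite /upd; do 2 (case: eqP => [?|_]; first by lia).
  - by move=> _; rewrite /upd /= iM'.
  - rewrite /upd /= e15; last by lia.
    by rewrite first_from_ge //; lia.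
have {}iM' : i = M.+1 by lia.
apply: (det_assign (v := rho i)); [by ev|by []|].
apply: H; rewrite ?h1 ?h2 ?nE //.
- by move=> r r13; rewrite /upd; do 2 (case: eqP => [?|_]; first by lia).
- by move=> ?; lia.
- by rewrite /upd /= iM'.
Qed.

Lemma ev_xor b R e1 e2 (x y : block b) : b <= k * B ->
  eval k B R e1 = x -> eval k B R e2 = y ->
  eval k B R (Bin OpXor e1 e2) = xorb_block x y.
Proof.
move=> bW h1 h2; rewrite val_xorb; apply: (ev_bin (o := OpXor)) => //=.
by apply: (@leq_trans (2 ^ b)); rewrite ?leq_exp2l // lxor_lt.
Qed.

Lemma p1_eq i i' : i < L -> i' < L -> (p1 i == p1 i') = (i == i').
Proof. by move=> iL i'L; apply/eqP/eqP => [/p1_inj->|->]. Qed.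

Lemma p2_eq i i' : i < L -> i' < L -> (p2 i == p2 i') = (i == i').
Proof. by move=> iL i'L; apply/eqP/eqP => [/p2_inj->|->]. Qed.

Definition wmask : finType := block (k * B).
Local Notation look w := (lookup (dummy (k * B) : wmask) w).

Definition build_events (t : nat) (r : wmask) : seq event :=
  let i := M.+1 - t in
  [:: Event false false sv0 (addr i) (share sv0 i);
      Event false false sv1 (addr i) (share sv1 i);
      Event false false sv2 (addr i) (share sv2 i);
      Event true false sv2 (2 * L + i) (p1 i);
      Event true false sv2 (3 * L + p1 i) (rho i);
      Event true true sv1 (4 * L + p1 i) r;
      Event true true sv2 (4 * L + p1 i) (xorb_block (node i) r)].

Lemma covers_build y0 es0 : public (regs y0) -> trace y0 = expands k B es0 ->
  (forall j a, a < 2 * L * k -> memory y0 j a = nth (dummy B) (inp j) a) ->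
  (forall e, e < L -> getw k (memory y0 sv2) (2 * L + e) = p1 e) ->
  (forall e, e < L -> getw k (memory y0 sv2) (3 * L + e) = p2 e) ->
  covers (I := tape (fun=> wmask) L) (exec (build mrg k) y0) (fun w y =>
    [/\ public (regs y), trace y = expands k B (es0 ++ tape_events (fun t _ => build_events t) w),
        regs y 14 = rho (hd true 0) /\ regs y 15 = rho (hd false 0),
        forall i, i < L ->
          getw k (memory y sv1) (4 * L + p1 i) = look w (M.+1 - i) /\
          getw k (memory y sv2) (4 * L + p1 i) = xorb_block (node i) (look w (M.+1 - i))
      & frame y0 y (fun j A => (j != sv0) && (A %/ L == 4))]).
Proof.
move=> pub0 tr0 raw0 area2 area3.
have LW := L_ltW; have bW := B_ltW; have pW := pow_ltW.
pose Inv t (w : tape (fun=> wmask) t) (y : state B) := regs y 5 = t /\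
    [/\ public (regs y), trace y = expands k B (es0 ++ tape_events (fun t _ => build_events t) w),
        (1 < t -> regs y 14 = rho (hd true (L - t))) /\
        (0 < t -> regs y 15 = rho (hd false (L - t))),
        forall t', t' < t ->
          getw k (memory y sv1) (4 * L + p1 (M.+1 - t')) = look w t' /\
          getw k (memory y sv2) (4 * L + p1 (M.+1 - t')) = xorb_block (node (M.+1 - t')) (look w t')
      & frame y0 y (fun j A => (j != sv0) && (A %/ L == 4))].
suff H : covers (exec (build mrg k) y0) (Inv L).
  apply: covers_impl H _ => w y [_ [? ? [h14 h15] mem ?]]; split=> //.
    by split; [rewrite h14 // subnn|rewrite h15 // subnn].
  move=> i iL; have [|] := mem (M.+1 - i); first by lia.
  by have -> : M.+1 - (M.+1 - i) = i by lia.
apply: covers_for => //.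
- by move=> t w y [e5 [[_ _ _ _ e4] _ _ _ _]]; split=> //; apply: ev_reg.
- move=> t w [R m tr] tL [e5 [pub etr [e14 e15] mem [fr1 fr2]]].
  move: e5 pub etr e14 e15 mem fr1 fr2 => e5 [e0 e1 e2 e3 e4] etr e14 e15 mem fr1 fr2.
  have {}etr : tr = expands k B (es0 ++ tape_events (fun t _ => build_events t) w) := etr.
  have {}e14 : 1 < t -> R 14 = rho (hd true (L - t)) := e14.
  have {}e15 : 0 < t -> R 15 = rho (hd false (L - t)) := e15.
  exists (fun (r : wmask) z => z = State (upd (upd R 7 0) 8 r) m tr).
    exact: covers_sampw.
  move=> r _ ->.
  pose i := M.+1 - t; have iL : i < L by rewrite /i; lia.
  have rW : r < W := ltn_ord r.
  have uW : xorb_block (node i) r < W := ltn_ord _.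
  have aiL := addr_low iL; have shW j := block_ltW (share j i).
  have shE j : m j (addr i) = share j i by rewrite -[m j]/(memory (State R m tr) j) fr2 // raw0.
  have q1 := p1_lt iL; have q2 := rho_lt iL.
  have zW := block_ltW (item i).
  apply: (det_assign (v := r)); [by ev|by []|].
  apply: (det_assign (v := i)); [by evto|by lia|].
  apply: (det_read k_gt0 (A := addr i)); first by apply: ev_item_addr => //; split; reg.
  apply: (det_read k_gt0 (A := addr i)); first by apply: ev_item_addr => //; split; reg.
  apply: (det_read k_gt0 (A := addr i)); first by apply: ev_item_addr => //; split; reg.
  rewrite !shE.
  apply: (det_assign (v := item i)); [| by [] |].
    by do 2 (apply: ev_xor; [by rewrite leq_pmull| |by ev]); ev.
  have area e c : e < L -> c <= 5 -> (c * L + e) * k + k <= W by move=> *; apply: area_addr.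
  have areaW e c : e < L -> c <= 5 -> c * L + e < W by move=> *; apply: area_lt.
  apply: (det_rdw k_gt0 B_gt0 (A := 2 * L + i)); [reg|by ev|exact: area|].
  rewrite fr1 ?area_div // area2 //.
  apply: (det_assign (v := p1 i)); [by ev|by lia|].
  apply: (det_rdw k_gt0 B_gt0 (A := 3 * L + p1 i)); [reg|by ev|exact: area|].
  rewrite fr1 ?area_div // area3 //.
  apply: (det_assign (v := rho i)); [by ev|by lia|].
  apply: (det_link (i := i)); try by [reg|split; reg].
  - move=> iM; rewrite /upd /= e14 /i; last by lia.
    by congr (rho (hd _ _)); lia.
  - move=> iM; rewrite /upd /= e15 /i; last by lia.
    by congr (rho (hd _ _)); lia.
  move=> R' keep f16 f5 f13 f14 f15.
  have [g0 g1 g2 g3 g4] : [/\ R' 0 = N, R' 1 = B, R' 2 = aw, R' 3 = M & R' 4 = L].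
    by split; rewrite keep //; reg.
  have [g5 g10 g11] : [/\ R' 5 = t, R' 10 = item i & R' 11 = p1 i].
    by split; rewrite ?f5 ?keep //; reg.
  have {}f16 : R' 16 = r by rewrite f16; reg.
  apply: (det_wrw k_gt0 B_gt0 (A := 4 * L + p1 i) (V := r)); [reg|by ev|by []|by ev|exact: area|].
  apply: (det_wrw k_gt0 B_gt0 (A := 4 * L + p1 i)
    (V := xorb_block (node i) r)); [reg| | | |exact: area|].
  - apply: ev_xor; [by []| |by ev].
    have := ltn_ord (node i); rewrite val_node // => nW; ev.
  - exact: ltn_ord.
  - by ev.
  apply: det_nil; split; first by reg.
  split; first by reg.
  split.
  - by split; reg.
  - by rewrite etr -!expands_rcons -!catA.
  - split=> h; rewrite /upd /=.
      by rewrite f14 /i; [congr (rho (hd _ _))|]; lia.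
    by rewrite f15 /i; congr (rho (hd _ _)); lia.
  - move=> t' t't; rewrite /= !getw_updm //=.
    have i'L : M.+1 - t' < L by lia.
    (* As [p1] is injective, the node written now overwrites no earlier one. *)
    rewrite !area_eq ?p1_lt // p1_eq //=.
    have -> : (M.+1 - t' == i) = (t' == t) by rewrite /i; lia.
    have [->|/eqP ne] := eqVneq t' t; first by rewrite -/i.
    by apply: mem; lia.
  split=> [j' A|j' a aL]; last by rewrite -fr2 //= !updm_low ?area_low.
  move=> h; rewrite -fr1 //= !getw_updm //.
  have [eA|_] := eqVneq A (4 * L + p1 i); last by rewrite !andbF.
  move: h; rewrite eA area_div // eqxx andbT negbK => /eqP ->.
  by [].
split; first by reg.
split=> //.
by rewrite /= cats0.
Qed.

Definition reshuffle_events (X1 X2 : nat -> wmask) (t : nat) (r : wmask) :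
    seq event :=
  [:: Event true false sv1 (4 * L + t) (X1 t);
      Event true false sv2 (4 * L + t) (X2 t);
      Event true false sv2 (3 * L + t) (p2 t);
      Event true true sv0 (5 * L + p2 t) r;
      Event true true sv2 (5 * L + p2 t) (xorb_block (xorb_block (X1 t) (X2 t)) r)].

Lemma covers_reshuffle y0 es0 (X1 X2 : nat -> wmask) :
  public (regs y0) -> trace y0 = expands k B es0 ->
  (forall e, e < L -> getw k (memory y0 sv2) (3 * L + e) = p2 e) ->
  (forall q, q < L -> getw k (memory y0 sv1) (4 * L + q) = X1 q) ->
  (forall q, q < L -> getw k (memory y0 sv2) (4 * L + q) = X2 q) ->
  covers (I := tape (fun=> wmask) L) (exec (reshuffle k) y0) (fun w y =>
    [/\ public (regs y),
        trace y = expands k B (es0 ++ tape_events (fun t _ => reshuffle_events X1 X2 t) w),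
        forall r, 12 <= r -> regs y r = regs y0 r
      & forall p, p < L ->
          getw k (memory y sv0) (5 * L + p2 p) = look w p /\
          getw k (memory y sv2) (5 * L + p2 p) =
            xorb_block (xorb_block (X1 p) (X2 p)) (look w p)]).
Proof.
move=> pub0 tr0 area3 mem1 mem2.
have LW := L_ltW.
pose Inv t (w : tape (fun=> wmask) t) (y : state B) := regs y 5 = t /\
    [/\ public (regs y),
        trace y = expands k B (es0 ++ tape_events (fun t _ => reshuffle_events X1 X2 t) w),
        forall r, 12 <= r -> regs y r = regs y0 r,
        forall p, p < t ->
          getw k (memory y sv0) (5 * L + p2 p) = look w p /\
          getw k (memory y sv2) (5 * L + p2 p) =
            xorb_block (xorb_block (X1 p) (X2 p)) (look w p)
      & frame y0 y (fun j A => (j != sv1) && (A %/ L == 5))].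
suff H : covers (exec (reshuffle k) y0) (Inv L).
  by apply: covers_impl H _ => w y [_ []].
apply: covers_for => //.
- by move=> t w y [e5 [[_ _ _ _ e4] _ _ _ _]]; split=> //; apply: ev_reg.
- move=> t w [R m tr] tL [e5 [[e0 e1 e2 e3 e4] etr keep mem [fr1 fr2]]].
  have {}etr : tr = expands k B (es0 ++ tape_events (fun t _ => reshuffle_events X1 X2 t) w) := etr.
  exists (fun (r : wmask) z => z = State (upd (upd R 7 0) 8 r) m tr).
    exact: covers_sampw.
  move=> r _ ->.
  have rW : r < W := ltn_ord r.
  have x1W : X1 t < W := ltn_ord _; have x2W : X2 t < W := ltn_ord _.
  have x12W : xorb_block (X1 t) (X2 t) < W := ltn_ord _.
  have uW : xorb_block (xorb_block (X1 t) (X2 t)) r < W := ltn_ord _.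
  have q2 := p2_lt tL.
  have area e c : e < L -> c <= 5 -> (c * L + e) * k + k <= W by move=> *; apply: area_addr.
  have areaW e c : e < L -> c <= 5 -> c * L + e < W by move=> *; apply: area_lt.
  apply: (det_assign (v := r)); [by ev|by []|].
  apply: (det_rdw k_gt0 B_gt0 (A := 4 * L + t)); [reg|by ev|exact: area|].
  rewrite fr1 ?area_div // mem1 //.
  apply: (det_assign (v := X1 t)); [by ev|by []|].
  apply: (det_rdw k_gt0 B_gt0 (A := 4 * L + t)); [reg|by ev|exact: area|].
  rewrite fr1 ?area_div // mem2 //.
  apply: (det_assign (v := xorb_block (X1 t) (X2 t)));
    [by apply: ev_xor; [by []|by ev|by ev]|by []|].
  apply: (det_rdw k_gt0 B_gt0 (A := 3 * L + t)); [reg|by ev|exact: area|].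
  rewrite fr1 ?area_div // area3 //.
  apply: (det_assign (v := p2 t)); [by ev|by lia|].
  apply: (det_wrw k_gt0 B_gt0 (A := 5 * L + p2 t) (V := r)); [reg|by ev|by []|by ev|exact: area|].
  apply: (det_wrw k_gt0 B_gt0 (A := 5 * L + p2 t)
    (V := xorb_block (xorb_block (X1 t) (X2 t)) r)); [reg| |by []|by ev|exact: area|].
    by apply: ev_xor; [by []|by ev|by ev].
  apply: det_nil; split; first by reg.
  split; first by reg.
  split.
  - by split; reg.
  - by rewrite etr -!expands_rcons -!catA.
  - move=> q q12; rewrite -keep // /upd /=.
    by repeat (case: eqP => [?|_]; first by lia).
  - move=> p pt; rewrite /= !getw_updm //=.
    have pL : p < L by lia.
    rewrite !area_eq ?p2_lt // p2_eq //=.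
    by have [->//|/eqP ne] := eqVneq p t; apply: mem; lia.
  split=> [j' A|j' a aL]; last by rewrite -fr2 //= !updm_low ?area_low.
  move=> h; rewrite -fr1 //= !getw_updm //.
  have [eA|_] := eqVneq A (5 * L + p2 t); last by rewrite !andbF.
  move: h; rewrite eA area_div // eqxx andbT negbK => /eqP ->.
  by [].
split; first by reg.
split=> //; first by rewrite /= cats0.
by move=> q q12; rewrite /upd /=; case: eqP => // ?; lia.
Qed.

Definition copy_events (Z : nat -> wmask) (t : nat) (u : unit) : seq event :=
  [:: Event true false sv2 (5 * L + t) (Z t); Event true true sv1 (5 * L + t) (Z t)].

Lemma covers_copy y0 es0 (Z : nat -> wmask) :
  public (regs y0) -> trace y0 = expands k B es0 ->
  (forall q, q < L -> getw k (memory y0 sv2) (5 * L + q) = Z q) ->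
  covers (I := tape (fun=> unit) L) (exec (copy k) y0) (fun w y =>
    [/\ public (regs y),
        trace y = expands k B (es0 ++ tape_events (fun t _ => copy_events Z t) w),
        forall r, 12 <= r -> regs y r = regs y0 r,
        forall q, q < L -> getw k (memory y sv1) (5 * L + q) = Z q
      & frame y0 y (fun j A => (j == sv1) && (A %/ L == 5))]).
Proof.
move=> pub0 tr0 mem2.
have LW := L_ltW.
pose Inv t (w : tape (fun=> unit) t) (y : state B) := regs y 5 = t /\
    [/\ public (regs y),
        trace y = expands k B (es0 ++ tape_events (fun t _ => copy_events Z t) w),
        forall r, 12 <= r -> regs y r = regs y0 r,
        forall q, q < t -> getw k (memory y sv1) (5 * L + q) = Z q
      & frame y0 y (fun j A => (j == sv1) && (A %/ L == 5))].
suff H : covers (exec (copy k) y0) (Inv L).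
  by apply: covers_impl H _ => w y [].
apply: covers_for => //.
- by move=> t w y [e5 [[_ _ _ _ e4] _ _ _ _]]; split=> //; apply: ev_reg.
- move=> t w [R m tr] tL [e5 [[e0 e1 e2 e3 e4] etr keep mem [fr1 fr2]]].
  have {}etr : tr = expands k B (es0 ++ tape_events (fun t _ => copy_events Z t) w) := etr.
  exists (fun _ z => z = State R m tr); first exact: covers_ret.
  move=> [] _ ->.
  have zW : Z t < W := ltn_ord _.
  have area e c : e < L -> c <= 5 -> (c * L + e) * k + k <= W by move=> *; apply: area_addr.
  have areaW e c : e < L -> c <= 5 -> c * L + e < W by move=> *; apply: area_lt.
  apply: (det_rdw k_gt0 B_gt0 (A := 5 * L + t)); [reg|by ev|exact: area|].
  rewrite fr1 ?area_div // mem2 //.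
  apply: (det_assign (v := Z t)); [by ev|by []|].
  apply: (det_wrw k_gt0 B_gt0 (A := 5 * L + t) (V := Z t)); [reg|by ev|by []|by ev|exact: area|].
  apply: det_nil; split; first by reg.
  split; first by reg.
  split.
  - by split; reg.
  - by rewrite etr -!expands_rcons -!catA.
  - move=> q q12; rewrite -keep // /upd /=.
    by repeat (case: eqP => [?|_]; first by lia).
  - move=> q qt; rewrite /= !getw_updm //=.
    have qL : q < L by lia.
    rewrite !area_eq //=.
    by have [->//|/eqP ne] := eqVneq q t; apply: mem; lia.
  split=> [j' A|j' a aL]; last by rewrite -fr2 //= !updm_low ?area_low.
  move=> h; rewrite -fr1 //= !getw_updm //.
  have [eA|_] := eqVneq A (5 * L + t); last by rewrite !andbF.
  by move: h; rewrite eA area_div // eqxx andbT => /negbTE ->.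
split; first by reg.
split=> //; first by rewrite /= cats0.
by move=> q q12; rewrite /upd /=; case: eqP => // ?; lia.
Qed.

Definition fetch_events (a : nat -> wmask) (i : nat) : seq event :=
  [:: Event true false sv0 (5 * L + rho i) (a i);
      Event true false sv1 (5 * L + rho i) (xorb_block (node i) (a i))].

Definition fetchable (m : 'Z_3 -> nat -> block B) (a : nat -> wmask) : Prop :=
  forall i, i < L -> getw k (m sv0) (5 * L + rho i) = a i /\
                     getw k (m sv1) (5 * L + rho i) = xorb_block (node i) (a i).

Lemma det_fetch a i r R m es cs Q : i < L -> 12 <= r -> fetchable m a ->
  R 1 = B -> R 4 = L -> R r = rho i ->
  (forall R', (forall q, (q < 6) || (12 <= q) -> R' q = R q) ->
     R' 10 = item i -> R' 11 = rho (nxt i) ->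
     det cs (State R' m (expands k B (es ++ fetch_events a i))) Q) ->
  det (fetch k r :: cs) (State R m (expands k B es)) Q.
Proof.
move=> iL r12 fm e1 e4 er H; have [a0 a1] := fm i iL.
have LW := L_ltW; have bW := B_ltW; have pW := pow_ltW.
have q2 := rho_lt iL; have q3 := rho_lt (succ_node_lt nclass iL).
have area e c : e < L -> c <= 5 -> (c * L + e) * k + k <= W by move=> *; apply: area_addr.
have areaW e c : e < L -> c <= 5 -> c * L + e < W by move=> *; apply: area_lt.
have aW : a i < W := ltn_ord _; have nW : node i < W := ltn_ord _.
have uW : xorb_block (node i) (a i) < W := ltn_ord _.
have zB := ltn_ord (item i); have zW := block_ltW (item i).
have neq q : q < 12 -> (r == q) = false by move=> q12; apply/eqP => ?; lia.
apply: det_seqs; rewrite [_ ++ _]/=.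
apply: (det_rdw k_gt0 B_gt0 (A := 5 * L + rho i)); [reg|by ev|exact: area|].
rewrite a0; apply: (det_assign (v := a i)); [by ev|by []|].
apply: (det_rdw k_gt0 B_gt0 (A := 5 * L + rho i)); [reg| |exact: area|].
  have h : upd (upd (upd (upd R 6 (5 * L + rho i)) 7 0) 8 (a i)) 9 (a i) r = rho i.
    by rewrite /upd !neq.
  by apply: ev_add; [ev|exact: ev_reg h|exact: areaW].
rewrite a1; apply: (det_assign (v := node i)) => //.
  apply: (@etrans nat _ (xorb_block (a i) (xorb_block (node i) (a i)))).
    by apply: ev_xor; [by []|by ev|by ev].
  by rewrite xorbC xorbK.
apply: (det_assign (v := item i)) => //.
  apply: (@etrans nat _ (node i %% (1 * 2 ^ B))).
    by apply: ev_mod; [ev|ev|apply: leq_ltn_trans nW; apply: leq_mod].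
  by rewrite mul1n val_node // addnC modnMDl modn_small.
apply: (det_assign (v := rho (nxt i))); first 2 last.
- rewrite -!expands_rcons -catA.
  apply: H; try reg.
  move=> q hq; rewrite /upd.
  by repeat (case: eqP => [?|_]; first by lia).
- apply: (@etrans nat _ (node i %/ 2 ^ B)).
    by apply: ev_shr; [ev|ev|apply: leq_ltn_trans nW; apply: leq_div].
  by rewrite val_node // addnC divnMDl ?expn_gt0 // divn_small // addn0.
- by lia.
Qed.

Lemma det_fetch_heads a R m es cs Q : fetchable m a -> public R ->
  R 14 = rho (hd true 0) -> R 15 = rho (hd false 0) ->
  (forall R', public R' -> R' 14 = rho (hd true 0) -> R' 15 = rho (hd false 0) ->
     R' 16 = item (hd true 0) -> R' 17 = rho (nxt (hd true 0)) ->
     R' 18 = item (hd false 0) -> R' 19 = rho (nxt (hd false 0)) ->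
     det cs (State R' m (expands k B
       (es ++ fetch_events a (hd true 0) ++ fetch_events a (hd false 0)))) Q) ->
  det (seqs (fetch_heads k) :: cs) (State R m (expands k B es)) Q.
Proof.
move=> fm [e0 e1 e2 e3 e4] e14 e15 H.
have h1L := first_from_lt M nclass true 0; have h2L := first_from_lt M nclass false 0.
have LW := L_ltW.
have rW j : j < L -> rho j < W by move/rho_lt; lia.
have iW j : item j < W := block_ltW _.
apply: det_seqs; rewrite [_ ++ _]/=.
apply: (det_fetch h1L _ fm) => // R1 keep1 r10 r11.
apply: (det_assign (v := item (hd true 0))); [by ev|by []|].
apply: (det_assign (v := rho (nxt (hd true 0)))); [by ev|by apply/rW/succ_node_lt|].
apply: (det_fetch h2L _ fm) => //; try by rewrite /upd /= keep1.
move=> R2 keep2 s10 s11.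
apply: (det_assign (v := item (hd false 0))); [by ev|by []|].
apply: (det_assign (v := rho (nxt (hd false 0)))); [by ev|by apply/rW/succ_node_lt|].
rewrite -catA; apply: H; rewrite /upd /= ?keep2 //= /upd /= ?keep1 //.
by split; rewrite /= ?keep2 //= /upd /= ?keep1 //=.
Qed.

Definition le_item (i i' : nat) : bool := block_le aw (item i) (item i').
Local Notation mnodes := (merged_nodes M nclass le_item).

Definition outshare (j : 'Z_3) (y : block B) (s : block B * block B) : block B :=
  if j == sv0 then s.1 else if j == sv1 then s.2 else xorb_block y (xorb_block s.1 s.2).

Definition share_pair : finType := (block B * block B)%type.
Local Notation looks w := (lookup ((dummy B, dummy B) : share_pair) w).

Definition traverse_events (a : nat -> wmask) (t : nat) (s : share_pair) : seq event :=
  let x := nth 0 mnodes t in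
  let o j : nat := outshare j (item x) s in
  fetch_events a (nxt x) ++
  [:: Event false true sv0 t (o sv0); Event false true sv0 (M + t) (o sv1);
      Event false true sv1 t (o sv1); Event false true sv1 (M + t) (o sv2);
      Event false true sv2 t (o sv2); Event false true sv2 (M + t) (o sv0)].

Lemma ev_laddr R r (x : block B) : R 1 = B -> R 2 = aw -> R r = x ->
  eval k B R (laddrE r) = laddr aw x.
Proof.
move=> e1 e2 er; have hW := half_ltW; have bW := B_ltW.
have LW := L_ltW.
rewrite /laddr -subn1.
have xm : x %% 2 ^ (B - 1) < W by apply: leq_ltn_trans (block_ltW x); apply: leq_mod.
have pW : 2 ^ (B - 1 - aw) < W.
  by apply: leq_ltn_trans pow_ltW; apply: pow_leW; lia.
have eh : eval k B R halfE = 2 ^ (B - 1).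
  by apply: (@etrans nat _ (1 * 2 ^ (B - 1))); [ev|exact: mul1n].
apply: ev_div.
- by apply: ev_mod.
- by rewrite -[RHS]mul1n; apply: ev_shl; [ev|ev|rewrite mul1n].
- by apply: leq_ltn_trans xm; apply: leq_div.
Qed.

Lemma ev_pop_first R h1 h2 : public R -> h1 < L -> h2 < L ->
  R 14 = rho h1 -> R 15 = rho h2 -> R 16 = item h1 -> R 17 = rho (nxt h1) ->
  R 18 = item h2 -> R 19 = rho (nxt h2) ->
  eval k B R pop_firstE = pop_first M le_item h1 h2.
Proof.
move=> [e0 e1 e2 e3 e4] h1L h2L r14 r15 r16 r17 r18 r19.
have hW := half_ltW; have bW := B_ltW; have LW := L_ltW.
have eh : eval k B R halfE = 2 ^ (B - 1).
  by apply: (@etrans nat _ (1 * 2 ^ (B - 1))); [ev|exact: mul1n].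
have l16 := ev_laddr e1 e2 r16; have l18 := ev_laddr e1 e2 r18.
(* Locations can be compared in place of nodes because [rho] is injective. *)
have rho_eq i i' : i < L -> i' < L -> (rho i == rho i') = (i == i').
  by move=> iL i'L; rewrite p2_eq ?p1_lt // p1_eq.
eapply etrans; first by rewrite /pop_firstE /leE; ev.
rewrite !rho_eq ?succ_node_lt // !succ_node_eq // /pop_first /le_item /block_le /is_real.
rewrite -!subn1 !eqb0 -!leqNgt -ltnNge.
move: (item h1) (item h2) => x1 x2.
case: (ltnP h1 M) => _ //=; case: (leqP M h2) => _ //=.
by rewrite [x2 < _]ltnNge; case: (2 ^ (B - 1) <= x2); case: (2 ^ (B - 1) <= x1);
  case: (laddr aw x1 <= _).
Qed.

Lemma updm_upd m j j' a a' x :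
  updm m j (fun f => upd f a x) j' a' =
  if (j' == j) && (a' == a) then x else m j' a' :> block B.
Proof. by rewrite /updm /upd; case: (j' == j). Qed.

Lemma getw_updm_upd m j j' a A x : a < A * k ->
  getw k (updm m j (fun f => upd f a x) j') A = getw k (m j') A.
Proof. by move=> aA; rewrite /updm; case: (j' == j) => //; apply: getw_upd. Qed.

Lemma Z3_cases (P : 'Z_3 -> Prop) : P sv0 -> P sv1 -> P sv2 -> forall j, P j.
Proof.
move=> p0 p1' p2'; case=> [[|[|[|//]]] h].
- by have -> : Ordinal h = sv0 by apply: val_inj.
- by have -> : Ordinal h = sv1 by apply: val_inj.
- by have -> : Ordinal h = sv2 by apply: val_inj.
Qed.

Lemma size_mnodes : size mnodes = M.
Proof. exact: size_merged_nodes. Qed.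

Lemma mnodes_lt t : t < M -> nth 0 mnodes t < M.
Proof.
move=> tM; have : nth 0 mnodes t \in mnodes by rewrite mem_nth ?size_mnodes.
by rewrite (perm_mem (perm_merged_nodes _ _ _)) mem_iota.
Qed.

Lemma covers_traverse y0 es0 a : fetchable (memory y0) a ->
  public (regs y0) -> trace y0 = expands k B es0 ->
  regs y0 14 = rho (hd true 0) -> regs y0 15 = rho (hd false 0) ->
  regs y0 16 = item (hd true 0) -> regs y0 17 = rho (nxt (hd true 0)) ->
  regs y0 18 = item (hd false 0) -> regs y0 19 = rho (nxt (hd false 0)) ->
  covers (I := tape (fun=> share_pair) M) (exec (traverse k) y0) (fun w y =>
    trace y = expands k B (es0 ++ tape_events (fun t _ => traverse_events a t) w) /\
    forall t j, t < M ->
      memory y j t = outshare j (item (nth 0 mnodes t)) (looks w t) /\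
      memory y j (M + t) = outshare (j + 1)%R (item (nth 0 mnodes t)) (looks w t)).
Proof.
move=> fm pub0 tr0 f14 f15 f16 f17 f18 f19.
have LW := L_ltW.
(* The entries not yet output are the merge of the two suffixes starting at [i1] and [i2], whose
   heads and their successors' locations are in the registers. *)
pose Inv t (w : tape (fun=> share_pair) t) (y : state B) := regs y 5 = t /\
    [/\ public (regs y),
      trace y = expands k B (es0 ++ tape_events (fun t _ => traverse_events a t) w),
      fetchable (memory y) a,
      exists i1 i2, drop t mnodes =
         merge le_item (class_from M nclass true i1) (class_from M nclass false i2) /\
       [/\ regs y 14 = rho (hd true i1), regs y 15 = rho (hd false i2),
           regs y 16 = item (hd true i1) /\ regs y 17 = rho (nxt (hd true i1)),
           regs y 18 = item (hd false i2) & regs y 19 = rho (nxt (hd false i2))]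
    & forall t' j, t' < t ->
      memory y j t' = outshare j (item (nth 0 mnodes t')) (looks w t') /\
      memory y j (M + t') = outshare (j + 1)%R (item (nth 0 mnodes t')) (looks w t')].
suff H : covers (exec (traverse k) y0) (Inv M).
  by apply: covers_impl H _ => w y [_ []].
apply: covers_for => //; first by lia.
- by move=> t w y [e5 [[_ _ _ e3 _] _ _ _ _]]; split=> //; apply: ev_reg.
- move=> t w [R m tr] tM [e5 [[e0 e1 e2 e3 e4] etr fm'
     [i1 [i2 [dr [r14 r15 [r16 r17] r18 r19]]]] mem]].
  have {}etr : tr = expands k B (es0 ++ tape_events (fun t _ => traverse_events a t) w) := etr.
  exists (fun (s : share_pair) z => z = State (upd (upd R 12 s.1) 13 s.2) m tr).
    have H : covers (exec (seqs [:: SampleBlock 12; SampleBlock 13]) (State R m tr))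
        (fun (s : block B * block B) z => z = State (upd (upd R 12 s.1) 13 s.2) m tr).
      apply: (covers_bind (f := exec (seqs [:: SampleBlock 13]))
        (R := fun (s1 s2 : block B) z => z = State (upd (upd R 12 s1) 13 s2) m tr)).
        exact: covers_sample_block.
      move=> s1 _ ->; apply: (covers_bind_det (f := exec Skip)).
        exact: covers_sample_block.
      by move=> s2 _ ->; eexists.
    exact: H.
  move=> [s0 s1] _ ->.
  have {}e5 : R 5 = t := e5.
  set h1 := hd true i1 in r14 r16 r17; set h2 := hd false i2 in r15 r18 r19.
  have h1L : h1 < L := first_from_lt M nclass true i1.
  have h2L : h2 < L := first_from_lt M nclass false i2.
  have rW j : j < L -> rho j < W by move/rho_lt; lia.
  have iW j : item j < W := block_ltW _.
  have := @merge_step M nclass le_item i1 i2; cbv zeta.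
  rewrite -dr size_drop size_mnodes subn_gt0 => /(_ tM).
  rewrite -/h1 -/h2 -!nth0 nth_drop addn0.
  set pop := pop_first M le_item h1 h2; set x := nth 0 mnodes t.
  move=> [xE bE xM n1 n2].
  have xL : x < L by lia.
  have nxL := succ_node_lt nclass xL.
  (* Popping a head moves the start of its suffix just past it; the new head is then the successor
     of the popped node, which is the node fetched. *)
  pose i1' := if pop then h1.+1 else i1; pose i2' := if pop then i2 else h2.+1.
  have part1 : det [:: Assign 20 pop_firstE;
      If (Reg 20)
        (seqs [:: Assign 21 (Reg 16); Assign 14 (Reg 17); Assign 22 (Reg 17)])
        (seqs [:: Assign 21 (Reg 18); Assign 15 (Reg 19); Assign 22 (Reg 19)])]
      (State (upd (upd R 12 s0) 13 s1) m tr)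
      (fun y => exists R2, y = State R2 m tr /\ [/\
         forall q, (q < 14) || (16 <= q < 20) -> R2 q = upd (upd R 12 s0) 13 s1 q,
         R2 20 = pop, R2 21 = item x, R2 22 = rho (nxt x)
       & R2 14 = rho (hd true i1') /\ R2 15 = rho (hd false i2')]).
    apply: (det_assign (v := pop)); [|by case: (pop); lia|].
      by apply: ev_pop_first => //; try split; rewrite /upd.
    apply: (det_if (v := pop)); first by ev.
    have [q1 q2] : (if pop then i1' = h1.+1 else i1' = i1) /\
        (if pop then i2' = i2 else i2' = h2.+1) by rewrite /i1' /i2'; case: (pop).
    move: xE n1 n2 q1 q2; case: (pop) => [xE /(_ isT) n1 _ -> ->|xE _ /(_ isT) n2 -> ->];
      rewrite [_ != 0]/= [_ ++ _]/= xE.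
      apply: (det_assign (v := item h1)); [by ev|by []|].
      apply: (det_assign (v := rho (nxt h1))); [by ev|by apply/rW/succ_node_lt|].
      apply: (det_assign (v := rho (nxt h1))); [by ev|by apply/rW/succ_node_lt|].
      apply: det_nil; eexists; split; first by [].
      split; try reg; last by split; rewrite /upd /= ?n1.
      move=> q hq; rewrite /upd.
      by do 4 (case: eqP => [?|_]; first by lia).
    apply: (det_assign (v := item h2)); [by ev|by []|].
    apply: (det_assign (v := rho (nxt h2))); [by ev|by apply/rW/succ_node_lt|].
    apply: (det_assign (v := rho (nxt h2))); [by ev|by apply/rW/succ_node_lt|].
    apply: det_nil; eexists; split; first by [].
    split; try reg; last by split; rewrite /upd /= ?n2.
    move=> q hq; rewrite /upd.
    by do 4 (case: eqP => [?|_]; first by lia).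
  rewrite -[_ :: _]/([:: _; _] ++ _); apply: det_cat; apply: det_impl part1 _.
  move=> _ [R2 [-> [k2 g20 g21 g22 [g14 g15]]]].
  rewrite etr; apply: (det_fetch nxL _ fm') => //; try by rewrite k2 // /upd.
  move=> R3 k3 g10 g11.
  have nP : if pop then nxt x = hd true i1' /\ hd false i2' = h2
            else nxt x = hd false i2' /\ hd true i1' = h1.
    move: n1 n2; rewrite xE /i1' /i2'; case: (pop) => [/(_ isT)|_ /(_ isT)];
    by rewrite -/h1 -/h2.
  have part2 : det [:: If (Reg 20)
        (seqs [:: Assign 16 (Reg 10); Assign 17 (Reg 11)])
        (seqs [:: Assign 18 (Reg 10); Assign 19 (Reg 11)])]
      (State R3 m (expands k B
         ((es0 ++ tape_events (fun t _ => traverse_events a t) w) ++ fetch_events a (nxt x))))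
      (fun y => exists R4, y = State R4 m (expands k B
         ((es0 ++ tape_events (fun t _ => traverse_events a t) w) ++ fetch_events a (nxt x))) /\
        [/\ forall q, (q < 16) || (20 <= q) -> R4 q = R3 q,
           R4 16 = item (hd true i1') /\ R4 17 = rho (nxt (hd true i1')),
           R4 18 = item (hd false i2') & R4 19 = rho (nxt (hd false i2'))]).
    apply: (det_if (v := pop)); first by apply: ev_reg; rewrite k3.
    have c16 : R3 16 = item h1 by rewrite k3 // k2.
    have c17 : R3 17 = rho (nxt h1) by rewrite k3 // k2.
    have c18 : R3 18 = item h2 by rewrite k3 // k2.
    have c19 : R3 19 = rho (nxt h2) by rewrite k3 // k2.
    have nnW : rho (nxt (nxt x)) < W by apply/rW/succ_node_lt.
    have inW := iW (nxt x).
    move: nP; case: (pop) => -[nE hE]; rewrite [_ != 0]/= [_ ++ _]/=.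
      apply: (det_assign (v := item (nxt x))); [by ev|by []|].
      apply: (det_assign (v := rho (nxt (nxt x)))); [by ev|by []|].
      apply: det_nil; eexists; split; first by [].
      rewrite hE -nE; split; try by [reg|split; reg].
      move=> q hq; rewrite /upd.
      by do 2 (case: eqP => [?|_]; first by lia).
    apply: (det_assign (v := item (nxt x))); [by ev|by []|].
    apply: (det_assign (v := rho (nxt (nxt x)))); [by ev|by []|].
    apply: det_nil; eexists; split; first by [].
    rewrite hE -nE; split; try by [reg|split; reg].
    move=> q hq; rewrite /upd.
    by do 2 (case: eqP => [?|_]; first by lia).
  rewrite -[_ :: _]/([:: _] ++ _); apply: det_cat; apply: det_impl part2 _.
  move=> _ [R4 [-> [k4 [f16' f17'] f18' f19']]].
  have k24 q : (q < 6) || (12 <= q < 14) -> R4 q = upd (upd R 12 s0) 13 s1 q.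
    by move=> hq; rewrite k4 ?k3 ?k2 //; lia.
  have [c0 c1 c2 c3 c4] : [/\ R4 0 = N, R4 1 = B, R4 2 = aw, R4 3 = M & R4 4 = L].
    by split; rewrite k24.
  have [c5 c12 c13] : [/\ R4 5 = t, R4 12 = s0 & R4 13 = s1] by split; rewrite k24.
  have [c14 c15] : R4 14 = rho (hd true i1') /\ R4 15 = rho (hd false i2').
    by split; rewrite k4 // k3.
  have c21 : R4 21 = item x by rewrite k4 // k3.
  have kB : B <= k * B by rewrite leq_pmull.
  pose o j := outshare j (item x) (s0, s1).
  apply: (det_assign (v := o sv2)); [|exact: block_ltW|].
    by apply: ev_xor; [by []|by ev|apply: ev_xor; [by []|by ev|by ev]].
  apply: (det_write (A := t) (V := o sv0)); [by ev|by ev|].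
  apply: (det_write (A := M + t) (V := o sv1)); [by ev|by ev|].
  apply: (det_write (A := t) (V := o sv1)); [by ev|by ev|].
  apply: (det_write (A := M + t) (V := o sv2)); [by ev|by ev|].
  apply: (det_write (A := t) (V := o sv2)); [by ev|by ev|].
  apply: (det_write (A := M + t) (V := o sv0)); [by ev|by ev|].
  rewrite !to_block_id; apply: det_nil; split; first by reg.
  split; first by reg.
  split.
  - by split; reg.
  - by rewrite -!expands_rcons -!catA.
  - move=> i iL; have q2 := rho_lt iL.
    (* Output cells have addresses below [2 * L], so writing them leaves the nodes in area 5
       intact. *)
    have low c b : 2 <= c -> b < 2 * L -> b < (c * L + rho i) * k.
      by move=> ? ?; apply: area_low => //; apply: leq_trans (leq_pmulr _ k_gt0).
    rewrite /= !getw_updm_upd; try (apply: low; lia).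
    exact: fm'.
  - exists i1', i2'; split; last first.
      by split; try split; rewrite /upd /=.
    rewrite -[t.+1]add1n -drop_drop drop1 bE /i1' /i2'; by case: (pop).
  - have tMn : (t == M + t) = false by lia.
    move=> t' j tt'; rewrite [memory _]/= [looks _ _]/= !updm_upd.
    have [->|/eqP ne] := eqVneq t' t.
      rewrite eqn_add2l eqxx tMn [M + t == t]eq_sym tMn -/x.
      by move: j; apply: Z3_cases.
    have t't : t' < t by lia.
    have -> : (t' == M + t) = false by lia.
    have -> : (M + t' == t) = false by lia.
    have -> : (M + t' == M + t) = false by lia.
    by rewrite !andbF; apply: mem.
split; first by reg.
split=> //; first by rewrite /= cats0.
by exists 0, 0; rewrite drop0.
Qed.

End Phases.

(** * Real and simulated runs *)

Lemma bindA (S T U : Type) (p : rand S) (f : S -> rand T) (g : T -> rand U) :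
  bind (bind p f) g = bind p (fun x => bind (f x) g).
Proof.
elim: p => [x|m c IH] //=; congr Unif.
by apply: functional_extensionality => i; apply: IH.
Qed.

Lemma bind_ret (S T : Type) (x : S) (f : S -> rand T) : bind (Ret x) f = f x.
Proof. by []. Qed.

Lemma covers_pair (I J : finType) (S T : Type) (p : rand (option S))
    (f : S -> rand (option T)) Q (R : I * J -> T -> Prop) :
  covers p Q -> (forall i x, Q i x -> covers (f x) (fun j => R (i, j))) ->
  covers (obind p f) R.
Proof.
move=> hp hf; apply: covers_impl (covers_bind (R := fun i j => R (i, j)) hp hf) _.
by case.
Qed.

Lemma covers_det k s B N fuel (I : finType) cs ds (st : state B) P
    (Q : I -> state B -> Prop) :
  det k s N fuel cs st P ->
  (forall y, P y -> covers (exec k s N fuel (seqs ds) y) Q) ->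
  covers (exec k s N fuel (seqs (cs ++ ds)) st) Q.
Proof. by case=> y e hy h; rewrite exec_cat e; apply: h. Qed.

Lemma cat_eq (T : Type) (e1 e2 f1 f2 : seq T) : e1 = e2 -> f1 = f2 -> e1 ++ f1 = e2 ++ f2.
Proof. by move=> -> ->. Qed.

(** * Tapes, tuples and permutations as indices of uniform choices *)

Section Tapes.
Variables (J : finType) (j0 : J).

Lemma lookup_inj n (w w' : tape (fun=> J) n) :
  (forall i, i < n -> lookup j0 w i = lookup j0 w' i) -> w = w'.
Proof.
elim: n w w' => [[] []//|n IH] [w j] [w' j'] h; congr pair.
  apply: IH => i ni; have := h i (leqW ni).
  by rewrite /=; case: eqP => // e; lia.
by have := h n (leqnn _); rewrite /= eqxx.
Qed.

Lemma card_tape n : #|tape (fun=> J) n| = #|J| ^ n.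
Proof. by elim: n => [|n IH]; rewrite ?card_unit //= card_prod IH expnSr. Qed.

Lemma tape_tuple n : exists2 h : n.-tuple J -> tape (fun=> J) n, bijective h &
  forall u i, i < n -> lookup j0 (h u) i = nth j0 u i.
Proof.
pose g (w : tape (fun=> J) n) := [tuple lookup j0 w i | i < n].
have gE w i : i < n -> nth j0 (g w) i = lookup j0 w i.
  by move=> ni; rewrite -[i]/(nat_of_ord (Ordinal ni)) -tnth_nth tnth_mktuple.
have [h gK hK] : bijective g.
  apply: inj_card_bij => [w w' E|]; last by rewrite card_tuple card_tape.
  by apply: lookup_inj => i ni; rewrite -!gE // E.
by exists h => [|u i ni]; [exists g|rewrite -gE // hK].
Qed.

Lemma tape_events_lookup n (ev : nat -> J -> seq event) (w : tape (fun=> J) n) :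
  tape_events (fun t _ => ev t) w = flatten [seq ev t (lookup j0 w t) | t <- iota 0 n].
Proof.
elim: n w => // n IH [w j].
have -> : iota 0 n.+1 = iota 0 n ++ [:: n] by rewrite -[n.+1]addn1 iotaD.
rewrite map_cat flatten_cat /= eqxx cats0 IH; congr (flatten _ ++ _).
apply/eq_in_map => t; rewrite mem_iota add0n /= => tn.
by case: eqP => // e; lia.
Qed.
End Tapes.

Lemma rev_tuple_bij n (J : Type) : bijective (fun u : n.-tuple J => [tuple of rev u]).
Proof.
by exists (fun u : n.-tuple J => [tuple of rev u]) => u; apply: val_inj; rewrite /= revK.
Qed.

(** The client draws both shares of an entry in the same iteration, whereas the functionality draws
    one whole array after the other. *)
Lemma zip_tuple_bij n (J K : finType) :
  bijective (fun u : n.-tuple J * n.-tuple K => [tuple of zip u.1 u.2]).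
Proof.
apply: inj_card_bij => [[u v] [u' v'] /(congr1 val) /= E|].
  have su := size_tuple u; have sv := size_tuple v.
  have su' := size_tuple u'; have sv' := size_tuple v'.
  congr pair; apply: val_inj => /=.
    by rewrite -(@unzip1_zip _ _ u v) ?su ?sv // E unzip1_zip ?su' ?sv'.
  by rewrite -(@unzip2_zip _ _ u v) ?su ?sv // E unzip2_zip ?su' ?sv'.
by rewrite card_prod !card_tuple card_prod expnMn.
Qed.

Definition permf n (s : 'S_n.+1) (i : nat) : nat := s (inord i).

Section PermFun.
Variables (n : nat) (s : 'S_n.+1).

Lemma permf_lt i : permf s i < n.+1.
Proof. exact: ltn_ord. Qed.

Lemma permf_inj i i' : i < n.+1 -> i' < n.+1 -> permf s i = permf s i' -> i = i'.
Proof.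
by move=> ni ni' /ord_inj /perm_inj /(congr1 val); rewrite /= !inordK.
Qed.

Lemma permfK i : i < n.+1 -> permf (s^-1)%g (permf s i) = i.
Proof. by move=> ni; rewrite /permf inord_val permK inordK. Qed.

Lemma permfKV i : i < n.+1 -> permf s (permf (s^-1)%g i) = i.
Proof. by move=> ni; rewrite /permf inord_val permKV inordK. Qed.

Lemma permfM (t : 'S_n.+1) i : permf (s * t)%g i = permf t (permf s i).
Proof. by rewrite /permf inord_val permM. Qed.
End PermFun.

Lemma perm_of_seq n (l : seq nat) : perm_eq l (iota 0 n.+1) ->
  exists s : 'S_n.+1, forall i, i < n.+1 -> permf s i = nth 0 l i.
Proof.
move=> hl; have sl : size l = n.+1 by rewrite (perm_size hl) size_iota.
have lt (i : 'I_n.+1) : nth 0 l i < n.+1.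
  have : nth 0 l i \in l by rewrite mem_nth ?sl.
  by rewrite (perm_mem hl) mem_iota.
have inj : injective (fun i => Ordinal (lt i)).
  move=> i j /(congr1 val) /= /eqP; rewrite nth_uniq ?sl //.
    by move/eqP/ord_inj.
  by rewrite (perm_uniq hl) iota_uniq.
by exists (perm inj) => i ni; rewrite /permf permE /= inordK.
Qed.

Section Run.
Variables (mrg : bool) (k N B aw fuel : nat).
Local Notation M := (nitems mrg N).
Local Notation L := M.+2.
Local Notation W := (2 ^ (k * B)).
Local Notation exec := (exec k 4 N fuel).
Hypothesis k_gt0 : 0 < k.
Hypothesis B_gt0 : 0 < B.
Hypothesis N_gt0 : 0 < N.
Hypothesis awB : aw < B.
Hypothesis addrW : 6 * L * k + 8 * L <= W.
Hypothesis nodeW : L * 2 ^ B <= W.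
Hypothesis fuelL : L <= fuel.
Variable shuf : 'S_L -> fytape L.
Hypothesis shuf_bij : bijective shuf.
Hypothesis shufE : forall s (i : 'I_L), nth 0 (fyseq (shuf s)) i = s i.

Lemma shuf_permf s i : i < L -> nth 0 (fyseq (shuf s)) i = permf s i.
Proof. by move=> iL; rewrite -[i in LHS](@inordK M.+1 i) // shufE. Qed.

(* r and r' are the pads of the two stages, u and u' the padded nodes; r and u are
   indexed by the nodes, r' and u' by their positions under p1.  The nodes are
   visited in the order v 0, v 1, ..., and o j is the output share j. *)
Section Events.
Variables (T : 'Z_3 -> nat -> nat) (s1 s2 : 'S_L).
Variables (r u r' u' : nat -> nat) (v : nat -> nat) (o : 'Z_3 -> nat -> nat).
Local Notation p1 := (permf s1).
Local Notation p2 := (permf s2).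
Local Notation q1 := (permf s1^-1%g).
Local Notation q2 := (permf s2^-1%g).

Definition build_step (t : nat) : seq event :=
  let i := M.+1 - t in
  [:: Event false false sv0 (addr mrg N i) (T sv0 i);
      Event false false sv1 (addr mrg N i) (T sv1 i);
      Event false false sv2 (addr mrg N i) (T sv2 i);
      Event true false sv2 (2 * L + i) (p1 i);
      Event true false sv2 (3 * L + p1 i) (p2 (p1 i));
      Event true true sv1 (4 * L + p1 i) (r i);
      Event true true sv2 (4 * L + p1 i) (u i)].

Definition reshuffle_step (t : nat) : seq event :=
  [:: Event true false sv1 (4 * L + t) (r (q1 t));
      Event true false sv2 (4 * L + t) (u (q1 t));
      Event true false sv2 (3 * L + t) (p2 t);
      Event true true sv0 (5 * L + p2 t) (r' t);
      Event true true sv2 (5 * L + p2 t) (u' t)].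

Definition copy_step (t : nat) : seq event :=
  [:: Event true false sv2 (5 * L + t) (u' (q2 t));
      Event true true sv1 (5 * L + t) (u' (q2 t))].

Definition fetch_step (i : nat) : seq event :=
  [:: Event true false sv0 (5 * L + p2 (p1 i)) (r' (p1 i));
      Event true false sv1 (5 * L + p2 (p1 i)) (u' (p1 i))].

Definition traverse_step (t : nat) : seq event :=
  fetch_step (v t.+2) ++
  [:: Event false true sv0 t (o sv0 t); Event false true sv0 (M + t) (o sv1 t);
      Event false true sv1 t (o sv1 t); Event false true sv1 (M + t) (o sv2 t);
      Event false true sv2 t (o sv2 t); Event false true sv2 (M + t) (o sv0 t)].

Definition run_events : seq event :=
  (((((tape_events (fy_events mrg N 2) (shuf s1) ++
      tape_events (fy_events mrg N 3) (shuf s2)) ++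
     flatten [seq build_step t | t <- iota 0 L]) ++
    flatten [seq reshuffle_step t | t <- iota 0 L]) ++
   flatten [seq copy_step t | t <- iota 0 L]) ++
  (fetch_step (v 0) ++ fetch_step (v 1))) ++
  flatten [seq traverse_step t | t <- iota 0 M].
End Events.

(** All coins but the output shares, which the functionality draws as well and which therefore must
    not be reindexed. The last component belongs to the copying loop, which uses no randomness. *)
Definition coins : finType :=
  ('S_L * ('S_L * (L.-tuple (wmask k B) * (L.-tuple (wmask k B) *
    tape (fun=> unit) L))))%type.

Variable inp : 'Z_3 -> seq (block B).
Local Notation item := (item mrg N inp).
Local Notation nclass := (nclass mrg N inp).
Local Notation mnodes := (merged_nodes M nclass (le_item mrg N aw inp)).

Definition order (t : nat) : nat := nth 0 (visits M nclass (le_item mrg N aw inp)) t.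

Definition out (Y0 Y1 : array B M) (j : 'Z_3) (t : nat) : block B :=
  outshare j (item (nth 0 mnodes t)) (nth (dummy B) Y0 t, nth (dummy B) Y1 t).

Definition mnode (s1 s2 : 'S_L) (i : nat) : wmask k B :=
  node mrg k N inp (permf s1) (permf s2) i.

Definition msk (R : L.-tuple (wmask k B)) (i : nat) : wmask k B :=
  nth (dummy (k * B)) R i.

Definition real_events (w : coins) (Y0 Y1 : array B M) : seq event :=
  let: (s1, (s2, (R, (R', _)))) := w in
  run_events (share mrg N inp) s1 s2
    (msk R) (fun i => xorb_block (mnode s1 s2 i) (msk R i))
    (msk R') (fun p => xorb_block (mnode s1 s2 (permf s1^-1%g p)) (msk R' p))
    order (out Y0 Y1).

(** Inputs must be blank from cell [2 * M] on because the areas of the two shuffles lie beyond it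
    and have to start with zeros. *)
Lemma covers_run :
  (forall j a, 2 * M <= a -> nth (dummy B) (inp j) a = dummy B) ->
  covers (I := (coins * (array B M * array B M))%type)
    (run (list_protocol mrg k) N aw fuel inp) (fun w st =>
      trace st = expands k B (real_events w.1 w.2.1 w.2.2) /\
      forall j t, t < M -> memory st j t = out w.2.1 w.2.2 j t /\
                           memory st j (M + t) = out w.2.1 w.2.2 (j + 1)%R t).
Proof.
pose flat (w : coins * (array B M * array B M)) :=
  let: ((s1, (s2, (R, (R', u)))), Y) := w in (s1, (s2, (R, (R', (u, Y))))).
have flat_bij : bijective flat.
  by exists (fun w => let: (s1, (s2, (R, (R', (u, Y))))) := w in
     ((s1, (s2, (R, (R', u)))), Y)) => [[[? [? [? [? ?]]]] ?]|[? [? [? [? [? ?]]]]]].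
move=> inp0.
suff : covers (run (list_protocol mrg k) N aw fuel inp) (fun w st =>
    let: (s1, (s2, (R, (R', (u, (Y0, Y1)))))) := w in
      trace st = expands k B (real_events (s1, (s2, (R, (R', u)))) Y0 Y1) /\
      forall j t, t < M -> memory st j t = out Y0 Y1 j t /\
                           memory st j (M + t) = out Y0 Y1 (j + 1)%R t).
  move/(covers_reindex flat_bij) => H; apply: covers_impl H _.
  by move=> [[? [? [? [? ?]]]] [? ?]] st.
have LW := L_ltW addrW; have NM : N <= M := item_le mrg N.
have bW := B_ltW B k_gt0.
have [ht htb htE] := tape_tuple (dummy (k * B) : wmask k B) L.
have [hp hpb hpE] := tape_tuple ((dummy B, dummy B) : share_pair B) M.
rewrite -[run _ _ _ _ _]/(exec (seqs ([:: seqs (prepare mrg)] ++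
  [:: shuffle k 2; shuffle k 3; build mrg k; reshuffle k; copy k;
      seqs (fetch_heads k); traverse k])) (init_state (list_protocol mrg k) N aw inp)).
set st0 := init_state _ _ _ _.
have st0E : st0 = State (fun q => word k B (nth 0 [:: N; B; aw] q))
  (fun j a => nth (dummy B) (inp j) a) (expands k B [::]) by [].
pose Q1 (y : state B) := [/\ public mrg N B aw (regs y), trace y = expands k B [::]
  & memory y = memory st0].
apply: (covers_det (P := Q1)).
  rewrite st0E; apply: det_seqs; rewrite [_ ++ _]/=.
  have w0 : word k B N = N by rewrite word_small //; lia.
  have w1 : word k B B = B by rewrite word_small.
  have w2 : word k B aw = aw by rewrite word_small //; lia.
  apply: (det_assign (v := M)); [|lia|].
    by rewrite /nitems; case: (mrg) NM LW => NM LW; ev.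
  apply: (det_assign (v := L)); [by evto|lia|].
  apply: det_nil; split=> //.
move=> y0 [pub0 tr0 mem0].
have zero c e : 2 <= c -> getw k (memory y0 sv2) (c * L + e) = 0.
  move=> c2; apply: getw_zero => a ha; rewrite mem0; apply: inp0.
  by apply: leq_trans ha; rewrite -[2 * M]muln1 leq_mul //; nia.
apply: (covers_pair (covers_reindex shuf_bij (covers_shuffle k_gt0 B_gt0 N_gt0 awB
  addrW nodeW fuelL (c := 2) isT pub0 tr0 (fun e _ => zero 2 e isT)))).
move=> s1 y1 [pub1 tr1 mem1 [fr1 fr1']].
apply: (covers_pair (covers_reindex shuf_bij (covers_shuffle k_gt0 B_gt0 N_gt0 awB
  addrW nodeW fuelL (c := 3) isT pub1 tr1 _))).
  by move=> e eL; rewrite fr1 ?area_div // zero.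
move=> s2 y2 [pub2 tr2 mem2 [fr2 fr2']].
(* Iteration [t] treats node [M.+1 - t]; reversing the tape indexes the pads by nodes. *)
have rtb := bij_comp htb (@rev_tuple_bij L (wmask k B)).
apply: (covers_pair (covers_reindex rtb (covers_build k_gt0 B_gt0 N_gt0 awB
  addrW nodeW fuelL (inp := inp) (p1 := permf s1) (p2 := permf s2) _ _ _ pub2 tr2 _ _ _))).
- by move=> i _; apply: permf_lt.
- by move=> i _; apply: permf_lt.
- by move=> i i'; apply: permf_inj.
- by move=> j b bL; rewrite fr2' // fr1' // mem0.
- by move=> e eL; rewrite fr2 ?area_div // mem1 // shuf_permf.
- by move=> e eL; rewrite mem2 // shuf_permf.
move=> R y3 [pub3 tr3 [h14 h15] mem3 [fr3 _]].
have RE i : i < L -> lookup (dummy (k * B) : wmask k B) (ht [tuple of rev R]) (M.+1 - i) = msk R i.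
  move=> iL; rewrite htE; last by lia.
  rewrite /= nth_rev size_tuple; last by lia.
  by congr nth; lia.
pose p1 := permf s1; pose p2 := permf s2; pose q1 := permf s1^-1%g; pose q2 := permf s2^-1%g.
have q1L i : q1 i < L by apply: permf_lt.
have q2L i : q2 i < L by apply: permf_lt.
have p1K i : i < L -> p1 (q1 i) = i by apply: permfKV.
have p2K i : i < L -> p2 (q2 i) = i by apply: permfKV.
have q1K i : i < L -> q1 (p1 i) = i by apply: permfK.
have q2K i : i < L -> q2 (p2 i) = i by apply: permfK.
pose X1 p : wmask k B := msk R (q1 p).
pose X2 p : wmask k B := xorb_block (mnode s1 s2 (q1 p)) (msk R (q1 p)).
have X12 p : xorb_block (X1 p) (X2 p) = mnode s1 s2 (q1 p) by rewrite /X1 /X2 xorbC xorbK.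
apply: (covers_pair (covers_reindex htb (covers_reshuffle k_gt0 B_gt0 N_gt0 awB
  addrW nodeW fuelL (p2 := p2) (X1 := X1) (X2 := X2) _ _ pub3 tr3 _ _ _))).
- by move=> i _; apply: permf_lt.
- by move=> i i'; apply: permf_inj.
- by move=> e eL; rewrite fr3 ?area_div // mem2 // shuf_permf.
- move=> q qL; have [h _] := mem3 (q1 q) (q1L q).
  by rewrite -[q in LHS](p1K q qL) h RE.
- move=> q qL; have [_ h] := mem3 (q1 q) (q1L q).
  by rewrite -[q in LHS](p1K q qL) h RE.
move=> R' y4 [pub4 tr4 keep4 mem4].
pose U' p : wmask k B := xorb_block (mnode s1 s2 (q1 p)) (msk R' p).
apply: (covers_pair (covers_copy k_gt0 B_gt0 N_gt0 awB addrW nodeW fuelL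
  (Z := fun q => U' (q2 q)) pub4 tr4 _)).
  move=> q qL; have [_ h] := mem4 (q2 q) (q2L q).
  by rewrite -[q in LHS](p2K q qL) h X12 htE.
move=> w5 y5 [pub5 tr5 keep5 mem5 [fr5 _]].
have fm : fetchable mrg N inp p1 p2 (memory y5) (fun i => msk R' (p1 i)).
  move=> i iL; have p1L : p1 i < L by apply: permf_lt.
  have p2L j : p2 j < L by apply: permf_lt.
  split; first by rewrite fr5 //; case: (mem4 (p1 i) p1L) => -> _; rewrite htE.
  by rewrite mem5 // q2K // /U' q1K.
have g14 : regs y5 14 = p2 (p1 (first_from M nclass true 0)) by rewrite keep5 // keep4.
have g15 : regs y5 15 = p2 (p1 (first_from M nclass false 0)) by rewrite keep5 // keep4.
set es5 := _ ++ tape_events (fun t _ => copy_events _ _ _ _) _ in tr5.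
pose fe i := fetch_events mrg N inp p1 p2 (fun i => msk R' (p1 i)) i.
pose h1 := first_from M nclass true 0; pose h2 := first_from M nclass false 0.
pose Q6 (y : state B) := [/\ public mrg N B aw (regs y) /\ memory y = memory y5,
  trace y = expands k B (es5 ++ fe h1 ++ fe h2),
  regs y 14 = p2 (p1 h1) /\ regs y 15 = p2 (p1 h2),
  regs y 16 = item h1 /\ regs y 17 = p2 (p1 (succ_node M nclass h1))
  & regs y 18 = item h2 /\ regs y 19 = p2 (p1 (succ_node M nclass h2))].
have p1L i : p1 i < L by apply: permf_lt.
have p2L i : p2 i < L by apply: permf_lt.
apply: (covers_det (cs := [:: seqs (fetch_heads k)]) (ds := [:: traverse k]) (P := Q6)).
  have y5E : y5 = State (regs y5) (memory y5) (expands k B es5).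
    by rewrite -tr5; case: (y5).
  rewrite [X in det _ _ _ _ _ X]y5E.
  apply: (det_fetch_heads k_gt0 B_gt0 N_gt0 awB addrW nodeW fuelL (inp := inp)
    (p1 := p1) (p2 := p2) _ _ fm pub5 g14 g15).
  - by move=> i _.
  - by move=> i _.
  by move=> *; apply: det_nil; split.
move=> y6 [[pub6 mem6] tr6 [f14 f15] [f16 f17] [f18 f19]].
rewrite -mem6 in fm.
have hzb := bij_comp hpb (@zip_tuple_bij M (block B) (block B)).
apply: (covers_bind_det (covers_reindex hzb (covers_traverse k_gt0 B_gt0 N_gt0 awB addrW
  nodeW fuelL (p1 := p1) (p2 := p2) _ _ _ _ fm pub6 tr6 f14 f15 f16 f17 f18 f19))).
- by move=> i _; apply: permf_lt.
- by move=> i _; apply: permf_lt.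
- by move=> i i'; apply: permf_inj.
- by move=> i i'; apply: permf_inj.
move=> [Y0 Y1] y7 [tr7 mem7]; exists y7 => //.
have pairE t : t < M -> lookup ((dummy B, dummy B) : share_pair B)
    (hp [tuple of zip Y0 Y1]) t = (nth (dummy B) Y0 t, nth (dummy B) Y1 t).
  by move=> tM; rewrite hpE //= nth_zip // !size_tuple.
split; last first.
  by move=> j t tM; have [-> ->] := mem7 t j tM; rewrite /= pairE.
rewrite tr7 /es5 /real_events /run_events; congr (expands _ _ _).
have flatE n (f g : nat -> seq event) : (forall t, t < n -> f t = g t) ->
    flatten (map f (iota 0 n)) = flatten (map g (iota 0 n)).
  by move=> fg; congr flatten; apply/eq_in_map => t; rewrite mem_iota => /fg.
have feE i : i < L -> fe i = fetch_step s1 s2 (msk R')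
    (fun p => xorb_block (mnode s1 s2 (permf s1^-1%g p)) (msk R' p)) i.
  by move=> iL; rewrite /fe /fetch_events /fetch_step -[permf s1^-1%g _]/(q1 (p1 i)) q1K.
rewrite !feE ?first_from_lt //.
rewrite !(tape_events_lookup (dummy (k * B) : wmask k B)) (tape_events_lookup tt).
rewrite (tape_events_lookup ((dummy B, dummy B) : share_pair B)).
apply: cat_eq.
  apply: cat_eq; last by [].
  apply: cat_eq; last by apply: flatE.
  apply: cat_eq; last by apply: flatE => t tL; rewrite /reshuffle_events X12 htE.
  apply: cat_eq; first by [].
  apply: flatE => t tL; have iL : M.+1 - t < L by lia.
  rewrite /build_events /build_step -(RE _ iL).
  by have -> : M.+1 - (M.+1 - t) = t by lia.
apply: flatE => t tL.
have nM := mnodes_lt aw inp tL.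
rewrite /traverse_events /traverse_step -[fetch_events _ _ _ _ _ _ _]/(fe _).
have vE : order t.+2 = succ_node M nclass (nth 0 mnodes t).
  by rewrite /order /= (nth_map 0) // size_mnodes.
rewrite feE -?vE; last by rewrite vE; apply: succ_node_lt; lia.
by rewrite /= pairE.
Qed.

(** * Simulated events and the change of coins *)

Definition sim_events (b : 'Z_3) (inpb : seq (block B)) (O0 O1 : array B M)
    (w : coins) : seq event :=
  let: (s1, (s2, (R, (R', _)))) := w in
  run_events (fun _ i => nth (dummy B) inpb (addr mrg N i)) s1 s2
    (msk R) (msk R) (msk R') (msk R') id
    (fun j t => if j == b then nth (dummy B) O0 t else nth (dummy B) O1 t).

Lemma redact_fy (b : 'Z_3) c n (w w' : fytape n) : b != sv2 ->
  map (redact b) (tape_events (fy_events mrg N c) w) =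
  map (redact b) (tape_events (fy_events mrg N c) w').
Proof.
rewrite eq_sym => /negbTE b2; elim: n w w' => // n IH [w j] [w' j'].
by rewrite /= !map_cat (IH w w') /= /redact /= !b2.
Qed.

Lemma map_flat (b : 'Z_3) n (f g : nat -> seq event) :
  (forall t, t < n -> map (redact b) (f t) = map (redact b) (g t)) ->
  map (redact b) (flatten (map f (iota 0 n))) = map (redact b) (flatten (map g (iota 0 n))).
Proof.
move=> fg; rewrite !map_flatten -!map_comp; congr flatten.
by apply/eq_in_map => t; rewrite mem_iota => /fg.
Qed.

Lemma mskE (f : 'I_L -> wmask k B) i : i < L -> msk [tuple f i | i < L] i = f (inord i).
Proof.
move=> iL; rewrite /msk -[in LHS](@inordK M.+1 i) //.
by rewrite -tnth_nth tnth_mktuple.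
Qed.

Lemma msk_tnth (R : L.-tuple (wmask k B)) (i : 'I_L) : tnth R i = msk R i.
Proof. exact: tnth_nth. Qed.

(* A simulated run visits the nodes in the order 0, 1, ... and its padded words
   are the pads themselves.  With sigma the real order of visits, server 0 sees
   p2 and p2 o p1 o sigma, server 1 sees p1, p2 o p1 o sigma and the padded
   nodes, server 2 sees p1, p2 and the padded nodes; each map below turns the
   coins of a real run into those of a simulated run with the same view. *)
Variable sigma : 'S_L.
Hypothesis sigmaE : forall t, t < L -> permf sigma t = order t.

Definition coins0 (w : coins) : coins :=
  let: (s1, (s2, (R, (R', u)))) := w in ((sigma * s1)%g, (s2, (R, (R', u)))).

(** Products of permutations apply the left factor first. Server 1 knows [p1], so the order of
    visits has to be absorbed by [p2]: the conjugate [pi] maps [p1 t] to [p1 (sigma t)], and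
    visiting node [t] under [pi * s2] hits the location of the real visit. The padded words move
    along with [pi]. *)
Definition coins1 (w : coins) : coins :=
  let: (s1, (s2, (R, (R', u)))) := w in
  let pi := (s1^-1 * sigma * s1)%g in
  (s1, ((pi * s2)%g, (R, ([tuple xorb_block (mnode s1 s2 ((s1^-1)%g (pi i)))
                                            (tnth R' (pi i)) | i < L], u)))).

Definition coins2 (w : coins) : coins :=
  let: (s1, (s2, (R, (R', u)))) := w in
  (s1, (s2, ([tuple xorb_block (mnode s1 s2 i) (tnth R i) | i < L],
     ([tuple xorb_block (mnode s1 s2 ((s1^-1)%g i)) (tnth R' i) | i < L], u)))).

Definition sim_coins (b : 'Z_3) : coins -> coins :=
  if b == sv0 then coins0 else if b == sv1 then coins1 else coins2.

(** Injectivity suffices, the set being finite. The permutations are recovered first; they determine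
    the nodes, and xor with a known node can be undone. *)
Lemma sim_coins_bij b : bijective (sim_coins b).
Proof.
apply: injF_bij; rewrite /sim_coins.
have tup (f : 'I_L -> wmask k B) (h : 'S_L) (R R' : L.-tuple (wmask k B)) :
    [seq xorb_block (f i) (tnth R (h i)) | i <- enum 'I_L] =
    [seq xorb_block (f i) (tnth R' (h i)) | i <- enum 'I_L] -> R = R'.
  move=> /eq_in_map E; apply: eq_from_tnth => i.
  by have := E ((h^-1)%g i) (mem_enum _ _); rewrite permKV => /xorb_inj.
have tup1 (f : 'I_L -> wmask k B) (R R' : L.-tuple (wmask k B)) :
    [seq xorb_block (f i) (tnth R i) | i <- enum 'I_L] =
    [seq xorb_block (f i) (tnth R' i) | i <- enum 'I_L] -> R = R'.
  move=> /eq_in_map E; apply: eq_from_tnth => i.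
  by have := E i (mem_enum _ _) => /xorb_inj.
case: (b == sv0); [|case: (b == sv1)]; move=> [s1 [s2 [R [R' u]]]] [t1 [t2 [S [S' v]]]].
- by case=> /mulgI <- <- <- <- <-.
- case=> <- /mulgI <- <- E <-.
  by rewrite (tup _ (s1^-1 * sigma * s1)%g _ _ E).
case=> <- <- E1 E2 <-.
by rewrite (tup1 _ _ _ E1) (tup1 _ _ _ E2).
Qed.


Definition outs (Y0 Y1 : array B M) (j : 'Z_3) : array B M :=
  [tuple out Y0 Y1 j t | t < M].

Lemma nth_outs Y0 Y1 j t : t < M -> nth (dummy B) (outs Y0 Y1 j) t = out Y0 Y1 j t.
Proof.
by move=> tM; rewrite -[t in LHS]/(nat_of_ord (Ordinal tM)) -tnth_nth tnth_mktuple.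
Qed.

Lemma redact_cat (b : 'Z_3) e1 e2 f1 f2 :
  map (redact b) e1 = map (redact b) f1 -> map (redact b) e2 = map (redact b) f2 ->
  map (redact b) (e1 ++ e2) = map (redact b) (f1 ++ f2).
Proof. by rewrite !map_cat => -> ->. Qed.

(** Only server 2 takes part in the shuffles: for it the permutations must agree, for the others
    these accesses are erased. Of the output, server [b] is sent the shares [b] and [b + 1] only. *)
Lemma redact_run b T T' s1 s2 t1 t2 r u r' u' ra ua ra' ua' v va o oa :
  (b != sv2 \/ s1 = t1 /\ s2 = t2) ->
  (forall t, t < L -> map (redact b) (build_step T s1 s2 r u t) =
                      map (redact b) (build_step T' t1 t2 ra ua t)) ->
  (forall t, t < L -> map (redact b) (reshuffle_step s1 s2 r u r' u' t) =
                      map (redact b) (reshuffle_step t1 t2 ra ua ra' ua' t)) ->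
  (forall t, t < L -> map (redact b) (copy_step s2 u' t) =
                      map (redact b) (copy_step t2 ua' t)) ->
  (forall t, t < L -> map (redact b) (fetch_step s1 s2 r' u' (v t)) =
                      map (redact b) (fetch_step t1 t2 ra' ua' (va t))) ->
  (forall t j, t < M -> j = b \/ j = (b + 1)%R -> o j t = oa j t) ->
  map (redact b) (run_events T s1 s2 r u r' u' v o) =
  map (redact b) (run_events T' t1 t2 ra ua ra' ua' va oa).
Proof.
move=> hfy hb hr hc hf ho; apply: redact_cat; last first.
  apply: map_flat => t tM; apply: redact_cat; first by apply: hf; lia.
  move: b ho {hfy hb hr hc hf}; apply: Z3_cases => ho;
    by rewrite /= /redact /= !ho //; ((by left) || (right; apply: val_inj)).
apply: redact_cat; last by apply: redact_cat; apply: hf.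
apply: redact_cat; last by apply: map_flat.
apply: redact_cat; last by apply: map_flat.
apply: redact_cat; last by apply: map_flat.
case: hfy => [b2|[-> ->] //].
by apply: redact_cat; apply: redact_fy.
Qed.

(** No server sees a pad together with the node padded by it: server 0 sees only [r'], server 1 sees
    [r] and [u'], server 2 sees [u] and [u']. Hence the simulated run can use one mask for both
    halves of a word. *)
Lemma redact_real_events b w Y0 Y1 :
  map (redact b) (real_events w Y0 Y1) =
  map (redact b) (sim_events b (inp b) (outs Y0 Y1 b) (outs Y0 Y1 (b + 1)%R) (sim_coins b w)).
Proof.
case: w => [s1 [s2 [R [R' w5]]]]; rewrite /real_events.
have pL (s : 'S_L) i : permf s i < L by apply: permf_lt.
have e10 : (sv1 == sv0) = false by []. have e20 : (sv2 == sv0) = false by [].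
have e21 : (sv2 == sv1) = false by []. have e01 : (sv0 == sv1) = false by [].
have e02 : (sv0 == sv2) = false by []. have e12 : (sv1 == sv2) = false by [].
have ho b' t j : t < M -> j = b' \/ j = (b' + 1)%R -> nat_of_ord (out Y0 Y1 j t) =
    (if j == b' then nth (dummy B) (outs Y0 Y1 b') t
     else nth (dummy B) (outs Y0 Y1 (b' + 1)%R) t).
  move=> tM [->|->]; first by rewrite eqxx nth_outs.
  by case: eqP => [e|_]; rewrite nth_outs // e.
move: b; apply: Z3_cases.
- apply: redact_run; [by left| | | | |exact: ho] => t tL.
  + by rewrite /build_step /= /redact /= ?e10 ?e20.
  + by rewrite /reshuffle_step /= /redact /= ?e10 ?e20.
  + by rewrite /copy_step /= /redact /= ?e10 ?e20.
  + by rewrite /fetch_step /= /redact /= ?e10 ?e20 permfM sigmaE.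
- have -> : sim_coins sv1 (s1, (s2, (R, (R', w5)))) = coins1 (s1, (s2, (R, (R', w5)))) by [].
  rewrite /coins1.
  set pi := (s1^-1 * sigma * s1)%g; set R'' := mktuple _.
  have R''E i : i < L -> msk R'' i =
      xorb_block (mnode s1 s2 (permf s1^-1%g (permf pi i))) (msk R' (permf pi i)).
    move=> iL; rewrite mskE // msk_tnth /permf.
    by rewrite inord_val.
  apply: redact_run; [by left| | | | |exact: ho] => t tL.
  + by rewrite /build_step /= /redact /= ?e01 ?e21.
  + by rewrite /reshuffle_step /= /redact /= ?e01 ?e21.
  (* The location [t] holds in the simulated run the word of index [(pi * s2)^-1 t], and [pi] turns
     this into the real index. *)
  + have piK : permf pi (permf (pi * s2)^-1%g t) = permf s2^-1%g t.
      by rewrite -permfM invMg mulgKV.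
    by rewrite /copy_step /= /redact /= ?e01 ?e21 R''E ?pL // piK.
  + have piE : permf pi (permf s1 t) = permf s1 (order t).
      by rewrite -permfM /pi !mulgA mulgV mul1g permfM sigmaE.
    by rewrite /fetch_step /= /redact /= ?e01 ?e21 R''E ?pL // permfM piE.
- have -> : sim_coins sv2 (s1, (s2, (R, (R', w5)))) = coins2 (s1, (s2, (R, (R', w5)))) by [].
  rewrite /coins2.
  apply: redact_run; [by right| | | | |exact: ho] => t tL.
  + rewrite /build_step /= /redact /= ?e02 ?e12 mskE; last by lia.
    by rewrite msk_tnth inordK //; lia.
  + rewrite /reshuffle_step /= /redact /= ?e02 ?e12 !mskE ?pL // !msk_tnth.
    by rewrite /permf !inordK // !inord_val.
  + by rewrite /copy_step mskE ?pL // msk_tnth /permf !inord_val.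
  + by rewrite /fetch_step /= /redact /= ?e02 ?e12.
Qed.


(** Real coins are reindexed by the inverse of [sim_coins b] while [Y0] and [Y1] stay fixed. The
    view thus remains coupled to the outputs of the other servers, as the joint distribution
    requires. *)
Lemma covers_outcome (b : 'Z_3) :
  (forall j a, 2 * M <= a -> nth (dummy B) (inp j) a = dummy B) ->
  covers (I := (array B M * (array B M * coins))%type)
    (obind (run (list_protocol mrg k) N aw fuel inp) (fun st =>
      Ret (Some (view_of inp st b, tt,
                 real_output M st (b + 1)%R, real_output M st (b + 2)%R))))
    (fun w y => y =
      ((inp b, redact_msgs b (expands k B
          (sim_events b (inp b) (outs w.1 w.2.1 b) (outs w.1 w.2.1 (b + 1)%R) w.2.2))), tt,
       (outs w.1 w.2.1 (b + 1)%R, outs w.1 w.2.1 (b + 1 + 1)%R),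
       (outs w.1 w.2.1 (b + 2)%R, outs w.1 w.2.1 (b + 2 + 1)%R))).
Proof.
move=> inp0; have [f fK Kf] := sim_coins_bij b.
pose h (w : array B M * (array B M * coins)) : coins * (array B M * array B M) :=
  (f w.2.2, (w.1, w.2.1)).
have h_bij : bijective h.
  exists (fun w => (w.2.1, (w.2.2, sim_coins b w.1))) => [[Y0 [Y1 c]]|[c [Y0 Y1]]];
    by rewrite /h /= ?fK ?Kf.
apply: (covers_bind_det (covers_reindex h_bij (covers_run inp0))).
move=> [Y0 [Y1 c]] st [/= tr mem]; eexists; first by [].
have outE j : real_output M st j = (outs Y0 Y1 j, outs Y0 Y1 (j + 1)%R).
  by congr pair; apply: eq_from_tnth => t; rewrite !tnth_mktuple; case: (mem j t (ltn_ord t)).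
rewrite !outE /view_of -/(redact_msgs b (trace st)) tr.
by rewrite (redact_expands _ _ (redact_real_events b (f c) Y0 Y1)) Kf.
Qed.

Definition out_array : array B M := [tuple item (nth 0 mnodes t) | t < M].

Lemma outs_sharing Y0 Y1 j : outs Y0 Y1 j =
  (if j == sv0 then Y0 else if j == sv1 then Y1
   else xor_array out_array (xor_array Y0 Y1)).
Proof.
apply: eq_from_tnth => t; rewrite tnth_mktuple /out /outshare.
by case: ifP => _; [|case: ifP => _]; rewrite /= -?tnth_nth // !tnth_mktuple.
Qed.

Lemma coins_gt0 : 0 < #|coins|.
Proof.
have [h _ _] := tape_tuple tt L; apply/card_gt0P.
by exists (1%g, (1%g, ([tuple dummy (k * B) | i < L], ([tuple dummy (k * B) | i < L],
  h [tuple tt | i < L])))).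
Qed.

(** The phases before the traversal make 20 accesses per node, the heads take 4 and each output
    entry 8; moreover [L] is at least 2. *)
Lemma size_real_events w Y0 Y1 : size (real_events w Y0 Y1) <= 30 * L.
Proof.
have sflat n c (f : nat -> seq event) : (forall t, size (f t) = c) ->
    size (flatten [seq f t | t <- iota 0 n]) = c * n.
  move=> fc; rewrite size_flatten /shape -map_comp (eq_map (g := fun=> c)) //.
  by rewrite sumnE big_map big_const_seq count_predT size_iota iter_addn_0.
have sfy c n (v : fytape n) : size (tape_events (fy_events mrg N c) v) = 3 * n.
  by elim: n v => // n IH v; rewrite /= size_cat IH /=; lia.
case: w => [s1 [s2 [R [R' u]]]]; rewrite /real_events /run_events.
rewrite 5!size_cat size_cat !sfy (sflat L 7) // (sflat L 5) // (sflat L 2) // (sflat M 8) //.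
by rewrite /fetch_step /=; lia.
Qed.

End Run.

(** * Perfect security from the coupling of coins *)

Section Security.
Variables (mrg : bool) (k N B aw fuel : nat).
Local Notation M := (nitems mrg N).
Local Notation L := M.+2.
Local Notation W := (2 ^ (k * B)).
Hypothesis k_gt0 : 0 < k.
Hypothesis B_gt0 : 0 < B.
Hypothesis N_gt0 : 0 < N.
Hypothesis awB : aw < B.
Hypothesis addrW : 6 * L * k + 8 * L <= W.
Hypothesis nodeW : L * 2 ^ B <= W.
Hypothesis fuelL : L <= fuel.

Lemma list_protocol_secure (b : 'Z_3) :
  exists Sim : seq (block B) -> array B M * array B M -> rand (view B),
  forall inp : 'Z_3 -> seq (block B),
  (forall j a, 2 * M <= a -> nth (dummy B) (inp j) a = dummy B) ->
  same_dist
    (bind (fresh_sharing (out_array mrg N aw inp)) (fun Y =>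
     bind (Sim (inp b) (server_output Y b)) (fun v =>
       Ret (Some (v, tt, server_output Y (b + 1)%R, server_output Y (b + 2)%R)))))
    (obind (run (list_protocol mrg k) N aw fuel inp) (fun st =>
      Ret (Some (view_of inp st b, tt,
                 real_output M st (b + 1)%R, real_output M st (b + 2)%R)))).
Proof.
have [shuf shuf_bij shufE] := fisher_yates L.
have /card_gt0P [c0 _] := coins_gt0 mrg k N B.
pose sim inpb (O : array B M * array B M) (c : coins mrg k N B) : view B :=
  (inpb, redact_msgs b (expands k B (sim_events shuf b inpb O.1 O.2 c))).
exists (fun inpb O => bind (uniform c0) (fun c => Ret (sim inpb O c))) => inp inp0.
(* The order of visits depends on the secret input, but it is introduced after the simulator has
   been fixed and occurs in the analysis only. *)
have [sigma sigmaE] := perm_of_seq (perm_visits M (nclass mrg N inp) (le_item mrg N aw inp)).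
have [F hF hFE] := covers_outcome k_gt0 B_gt0 N_gt0 awB addrW nodeW fuelL
  shuf_bij shufE sigmaE b inp0.
pose o := @outs mrg N B aw inp.
pose G (w : array B M * (array B M * coins mrg k N B)) : outcome B M :=
  (sim (inp b) (o w.1 w.2.1 b, o w.1 w.2.1 (b + 1)%R) w.2.2, tt,
   (o w.1 w.2.1 (b + 1)%R, o w.1 w.2.1 (b + 1 + 1)%R),
   (o w.1 w.2.1 (b + 2)%R, o w.1 w.2.1 (b + 2 + 1)%R)).
apply: (samples_same_dist (F := Some \o G) _ hF); last by move=> w /=; rewrite hFE.
rewrite /fresh_sharing bindA.
apply: (samples_bind (F := id) (G := fun Y0 w => Some (G (Y0, w)))).
  exact: samples_uniform.
move=> Y0; rewrite bindA.
apply: (samples_bind (F := id) (G := fun Y1 c => Some (G (Y0, (Y1, c))))).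
  exact: samples_uniform.
move=> Y1; rewrite bind_ret.
set Y := (Y in server_output Y b).
have YE j : server_output Y j = (o Y0 Y1 j, o Y0 Y1 (j + 1)%R).
  by congr pair; rewrite /o outs_sharing.
rewrite bindA !YE.
exact: (samples_map (fun c => Some (G (Y0, (Y1, c)))) (samples_uniform c0)).
Qed.
End Security.

(** * The merged lists are the arrays of the functionalities *)

Lemma out_array_merge mrg N B aw (inp : 'Z_3 -> seq (block B)) :
  out_array mrg N aw inp = [tuple nth (dummy B) (merge (block_le aw)
    [seq item mrg N inp i | i <- class_from (nitems mrg N) (nclass mrg N inp) true 0]
    [seq item mrg N inp i | i <- class_from (nitems mrg N) (nclass mrg N inp) false 0]) t
    | t < nitems mrg N].
Proof.
apply: eq_from_tnth => t; rewrite !tnth_mktuple merge_map (nth_map 0) //.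
by rewrite size_merged_nodes.
Qed.

Lemma xor_array_nth B n (X Y : array B n) i : i < n ->
  nth (dummy B) (xor_array X Y) i =
  xorb_block (nth (dummy B) X i) (nth (dummy B) Y i).
Proof.
move=> ni; rewrite -[i]/(nat_of_ord (Ordinal ni)) -!tnth_nth.
by rewrite tnth_mktuple.
Qed.

Lemma reconstruct_nth B n (X : sharing B n) i : i < n ->
  nth (dummy B) (reconstruct X) i =
  xorb_block (xorb_block (nth (dummy B) (X sv0) i) (nth (dummy B) (X sv1) i))
    (nth (dummy B) (X sv2) i).
Proof. by move=> ni; rewrite !xor_array_nth. Qed.

(** [block_le x y] holds for every [x] once [y] is a dummy, so merging the real blocks with the
    dummies is a concatenation, which keeps the input order of the real blocks. *)
Lemma out_array_compact N B aw (X : sharing B N) : well_formed (reconstruct X) ->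
  out_array false N aw (fun b => X b ++ X (b + 1)%R) = compacted (reconstruct X).
Proof.
move=> wf; pose inp b : seq (block B) := X b ++ X (b + 1)%R; rewrite out_array_merge -/inp.
have itemE i : i < N -> item false N inp i = nth (dummy B) (reconstruct X) i.
  by move=> iN; rewrite reconstruct_nth // /item /share /addr /inp !nth_cat !size_tuple iN.
have mapE : map (item false N inp) (iota 0 N) = reconstruct X.
  apply: (@eq_from_nth _ (dummy B)); rewrite size_map size_iota ?size_tuple // => i iN.
  by rewrite (nth_map 0) ?size_iota // nth_iota // add0n itemE.
have classE b : [seq item false N inp i | i <- class_from N (nclass false N inp) b 0] =
    [seq x <- reconstruct X | is_real x == b].
  by rewrite /class_from subn0 -mapE filter_map.
rewrite /nitems !classE.
have dum : all (pred1 (dummy B)) [seq x <- reconstruct X | is_real x == false].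
  rewrite all_filter; apply/allP => x xX /=; apply/implyP => /eqP nr.
  by have /allP/(_ x xX) := wf; rewrite nr.
rewrite allrel_merge; last first.
  apply/allrelP => x y _ yD; move/allP: dum => /(_ y yD) /eqP ->.
  rewrite /block_le /is_real /= mod0n leqNgt expn_gt0 //.
apply: eq_from_tnth => t; rewrite !tnth_mktuple nth_cat.
rewrite (eq_filter (a1 := fun x => is_real x == true) (a2 := @is_real B)); last first.
  by move=> x; rewrite eqb_id.
(* Past the real blocks, a dummy comes either from the second list or from the default of [nth]. *)
case: ltnP => // h; rewrite [RHS]nth_default //.
have [lt|ge] := ltnP (t - size [seq x <- reconstruct X | is_real x])
   (size [seq x <- reconstruct X | is_real x == false]).
  by move/all_nthP: dum => /(_ (dummy B) _ lt) /eqP.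
by rewrite nth_default.
Qed.

Lemma out_array_merged N B aw (X Y : sharing B N) :
  out_array true N aw (fun b => X b ++ X (b + 1)%R ++ Y b ++ Y (b + 1)%R) =
  merged aw (reconstruct X) (reconstruct Y).
Proof.
pose inp b : seq (block B) := X b ++ X (b + 1)%R ++ Y b ++ Y (b + 1)%R.
rewrite out_array_merge -/inp.
have sX j : size (X j) = N by rewrite size_tuple.
have sY j : size (Y j) = N by rewrite size_tuple.
have itemX i : i < N -> item true N inp i = nth (dummy B) (reconstruct X) i.
  move=> iN; rewrite reconstruct_nth // /item /share /addr /inp iN addn0.
  by rewrite !nth_cat !sX iN.
have itemY i : i < N -> item true N inp (N + i) = nth (dummy B) (reconstruct Y) i.
  move=> iN; rewrite reconstruct_nth // /item /share /addr /inp.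
  rewrite ltnNge leq_addr mul1n !nth_cat !sX !sY.
  (* The offset [N + N] skips the two shares of the first array. *)
  have -> : (N + i + N < N) = false by lia.
  have -> : (N + i + N - N < N) = false by lia.
  have -> : (N + i + N - N - N) = i by lia.
  by rewrite iN.
have E1 : [seq item true N inp i | i <- class_from (nitems true N) (nclass true N inp) true 0] =
    reconstruct X.
  rewrite /class_from /nitems subn0 iotaD filter_cat add0n.
  rewrite (@eq_in_filter _ _ predT (iota 0 N)); last first.
    by move=> i; rewrite mem_iota /nclass => /andP[_ ->].
  rewrite filter_predT (@eq_in_filter _ _ pred0 (iota N N)); last first.
    by move=> i; rewrite mem_iota /nclass => /andP[Ni _]; rewrite ltnNge Ni.
  rewrite filter_pred0 cats0.
  apply: (@eq_from_nth _ (dummy B)); rewrite size_map size_iota ?size_tuple // => i iN.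
  by rewrite (nth_map 0) ?size_iota // nth_iota // add0n itemX.
have E2 : [seq item true N inp i | i <- class_from (nitems true N) (nclass true N inp) false 0] =
    reconstruct Y.
  rewrite /class_from /nitems subn0 iotaD filter_cat add0n.
  rewrite (@eq_in_filter _ _ pred0 (iota 0 N)); last first.
    by move=> i; rewrite mem_iota /nclass => /andP[_ ->].
  rewrite filter_pred0 (@eq_in_filter _ _ predT (iota N N)); last first.
    by move=> i; rewrite mem_iota /nclass => /andP[Ni _]; rewrite ltnNge Ni.
  rewrite filter_predT cat0s.
  apply: (@eq_from_nth _ (dummy B)); rewrite size_map size_iota ?size_tuple // => i iN.
  by rewrite (nth_map 0) ?size_iota // nth_iota // itemY.
by rewrite E1 E2.
Qed.

(** * The word width and the bandwidth constant *)

Lemma word_bounds mrg d N B : 0 < N -> 0 < B -> up_log 2 N <= d * B ->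
  let L := (nitems mrg N).+2 in let k := d + d + 10 in
  6 * L * k + 8 * L <= 2 ^ (k * B) /\ L * 2 ^ B <= 2 ^ (k * B).
Proof.
move=> N0 B0 NB /=.
have N2 : N <= 2 ^ (d * B) by apply: leq_trans (up_logP N (isT : 1 < 2)) _; rewrite leq_exp2l.
have L4 : (nitems mrg N).+2 <= 4 * N by rewrite /nitems; case: mrg; lia.
have d2 : d < 2 ^ d by apply: ltn_expl.
(* As [L <= 4 * N], the left side of the first bound is at most [N * (24 * k + 32)]. Of the [k]
   blocks, [d] account for the factor [N] and the other [d + 10] for the second factor. *)
have c2 : 24 * (d + d + 10) + 32 <= 2 ^ ((d + 10) * B).
  apply: (@leq_trans (2 ^ (d + 10))); last by rewrite leq_exp2l // leq_pmulr.
  by rewrite expnD (_ : 2 ^ 10 = 1024) //; lia.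
have -> : (d + d + 10) * B = d * B + (d + 10) * B by rewrite -addnA mulnDl.
rewrite expnD; split.
  move: (2 ^ (d * B)) (2 ^ ((d + 10) * B)) N2 c2 => x y Nx cy.
  move: (nitems mrg N).+2 (d + d + 10) L4 cy => l k l4 cy.
  apply: (@leq_trans (N * (24 * k + 32))); first nia.
  exact: leq_mul.
apply: (@leq_trans (4 * N * 2 ^ B)); first by rewrite leq_mul2r L4 orbT.
rewrite [4 * N]mulnC -mulnA; apply: leq_mul => //.
rewrite -[4]/(2 ^ 2) -expnD leq_exp2l //; nia.
Qed.

(** Origin of the constant: at most [30 * L] accesses of at most [k.+1 * k.+1] messages, with
    [L <= 4 * N]. *)
Lemma bandwidth_bound k L N : L <= 4 * N ->
  30 * L * (k.+1 * k.+1) <= 120 * (k.+1 * k.+1) * N.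
Proof. by move=> h; move: (k.+1 * k.+1) => x; nia. Qed.

Lemma list_protocol_bandwidth mrg k N B aw fuel (inp : 'Z_3 -> seq (block B)) :
  let L := (nitems mrg N).+2 in
  0 < k -> 0 < B -> 0 < N -> aw < B ->
  6 * L * k + 8 * L <= 2 ^ (k * B) -> L * 2 ^ B <= 2 ^ (k * B) -> L <= fuel ->
  (forall j a, 2 * nitems mrg N <= a -> nth (dummy B) (inp j) a = dummy B) ->
  Pr (run (list_protocol mrg k) N aw fuel inp)
     (fun o => if o is Some st then size (trace st) <= 120 * (k.+1 * k.+1) * N else false)
  = 1%R.
Proof.
move=> L k0 B0 N0 awB addrW nodeW fuelL inp0.
have [shuf shuf_bij shufE] := fisher_yates L.
have [F hF hFE] := covers_run k0 B0 N0 awB addrW nodeW fuelL shuf_bij shufE inp0.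
apply: (samples_Pr1 _ hF) => [|w].
  have /card_gt0P [c _] := coins_gt0 mrg k N B; apply/card_gt0P.
  by exists (c, ([tuple dummy B | _ < nitems mrg N], [tuple dummy B | _ < nitems mrg N])).
have [tr _] := hFE w; rewrite /= tr.
apply: leq_trans (size_expands _ _ _) _.
apply: (@leq_trans (30 * L * (k.+1 * k.+1))).
  by rewrite leq_mul2r (size_real_events k0 B0 N0 awB addrW nodeW fuelL) orbT.
by apply: bandwidth_bound; rewrite /L /nitems; case: (mrg); lia.
Qed.

Theorem theorem2 (d : nat) :
  (exists (P : protocol) (C : nat), forall N B aw : nat,
     0 < N -> aw < B -> up_log 2 N <= d * B ->
     exists fuel : nat,
       perfectly_realizes P (F_compact B N) N aw fuel /\
       bandwidth_le P (F_compact B N) N aw fuel (C * N)) /\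
  (exists (P : protocol) (C : nat), forall N B aw : nat,
     0 < N -> aw < B -> up_log 2 N <= d * B ->
     exists fuel : nat,
       perfectly_realizes P (F_merge B aw N) N aw fuel /\
       bandwidth_le P (F_merge B aw N) N aw fuel (C * N)).
Proof.
pose k := d + d + 10; have k0 : 0 < k by rewrite /k addn_gt0 orbT.
split; [exists (list_protocol false k)|exists (list_protocol true k)];
  exists (120 * (k.+1 * k.+1)) => N B aw N0 awB NB.
- have B0 : 0 < B by apply: leq_ltn_trans awB.
  have [addrW nodeW] := word_bounds false N0 B0 NB.
  have inp0 (x : sharing B N) j a : 2 * N <= a -> nth (dummy B) (x j ++ x (j + 1)%R) a = dummy B.
    by move=> h; rewrite nth_default // size_cat !size_tuple addnn -mul2n.
  (* The fuel is [L], the number of iterations of the longest loops. *)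
  exists (nitems false N).+2; split=> [b|x _].
    have [Sim hS] := list_protocol_secure k0 B0 N0 awB addrW nodeW (leqnn _) b.
    exists Sim => x wf.
    have := hS (fun b => x b ++ x (b + 1)%R) (inp0 x).
    by rewrite out_array_compact.
  exact: (list_protocol_bandwidth k0 B0 N0 awB addrW nodeW (leqnn _) (inp0 x)).
have B0 : 0 < B by apply: leq_ltn_trans awB.
have [addrW nodeW] := word_bounds true N0 B0 NB.
have inp0 (x : sharing B N * sharing B N) j a : 2 * (N + N) <= a ->
    nth (dummy B) (x.1 j ++ x.1 (j + 1)%R ++ x.2 j ++ x.2 (j + 1)%R) a = dummy B.
  by move=> h; rewrite nth_default // !size_cat !size_tuple; lia.
exists (nitems true N).+2; split=> [b|x _].
  have [Sim hS] := list_protocol_secure k0 B0 N0 awB addrW nodeW (leqnn _) b.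
  exists Sim => x _.
  have := hS _ (inp0 x).
  by rewrite out_array_merged.
exact: (list_protocol_bandwidth k0 B0 N0 awB addrW nodeW (leqnn _) (inp0 x)).
Qed.
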